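(* Let $\mathbb{F}$ be an algebraically closed field of characteristic different from $2$. Then there are exactly two fine involution preserving gradings, up to equivalence, on the Smirnov algebra $\mathrm{T}(\mathcal{C})$ over $\mathbb{F}$ (where $\mathcal{C}$ is the Cayley algebra over $\mathbb{F}$). These have universal groups $\mathbb{Z}^2$ and $(\mathbb{Z}/2)^3$.
   Context: A Cayley algebra is an $8$-dimensional unital algebra with a nondegenerate multiplicative quadratic form $n$ (unique up to isomorphism over algebraically closed $\mathbb{F}$); write $n(x,y)=n(x+y)-n(x)-n(y)$, $\bar x=n(x,1)1-x$, and let $\mathcal{S}=\{x\in\mathcal{C}:\bar x=-x\}$ ($\dim\mathcal{S}=7$), which is closed under the commutator $[x,y]=xy-yx$ of $\mathcal{C}$. Smirnov algebra: let $\mathcal{H}=(\mathcal{S}\otimes\mathcal{S})/M$, with $M=\mathrm{span}\{s_1\otimes s_2-s_2\otimes s_1\}$, and write $s_1\times s_2$ for the class of $s_1\otimes s_2$. On $\mathrm{T}(\mathcal{C})=\mathcal{H}\oplus\mathcal{S}$ define a commutative product $\odot$ and an anticommutative product $[\cdot,\cdot]$ by, for $s,s_i\in\mathcal{S}$, $$s_1\odot s_2=s_1\times s_2,\qquad s\odot(s_1\times s_2)=-n(s_1,s_2)s-\tfrac12\big(n(s,s_1)s_2+n(s,s_2)s_1\big),$$ $$(s_1\times s_2)\odot(s_3\times s_4)=\tfrac14\big([s_1,s_3]\times[s_2,s_4]+[s_1,s_4]\times[s_2,s_3]\big)-n(s_1,s_2)\,s_3\times s_4-n(s_3,s_4)\,s_1\times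 s_2,$$ $[s_1,s_2]$ equal to the commutator in $\mathcal{C}$, $\ [s,s_1\times s_2]=[s,s_1]\times s_2+s_1\times[s,s_2]$, and $$[s_1\times s_2,s_3\times s_4]=-\tfrac12\big(n(s_1,s_3)[s_2,s_4]+n(s_1,s_4)[s_2,s_3]+n(s_2,s_3)[s_1,s_4]+n(s_2,s_4)[s_1,s_3]\big).$$ The product of $\mathrm{T}(\mathcal{C})$ is $xy=x\odot y+\tfrac12[x,y]$, and its involution is $h+s\mapsto h-s$ ($h\in\mathcal{H}$, $s\in\mathcal{S}$). It is a $35$-dimensional unital algebra with involution. An involution preserving $G$-grading ($G$ an abelian group) on $(\mathcal{A},-)$ is a decomposition $\mathcal{A}=\bigoplus_{g\in G}\mathcal{A}_g$ with $\mathcal{A}_g\mathcal{A}_h\subseteq\mathcal{A}_{gh}$ and $\overline{\mathcal{A}_g}\subseteq\mathcal{A}_g$. Two such gradings (by possibly different groups) are equivalent if there is an automorphism of $\mathcal{A}$ commuting with the involution and mapping each nonzero component of the first onto a nonzero component of the second (inducing a bijection of supports). A grading is fine if it has no proper refinement, a refinement being a grading each of whose components is contained in a component of the given one (proper if some inclusion is strict). The universal group of a grading is the abelian group generated by its support subject to the relations $gh=k$ whenever $0\neq\mathcal{A}_g\mathcal{A}_h\subseteq\mathcal{A}_k$. *)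

(* Defs.v *)
From HB Require Import structures.
From mathcomp Require Import all_boot all_order all_algebra.
From mathcomp Require Import generic_quotient ring_quotient sesquilinear.
From mathcomp Require Import boolp ring.

Set Implicit Arguments.
Unset Strict Implicit.
Unset Printing Implicit Defensive.

Import GRing.Theory.
Local Open Scope ring_scope.

Section Polar.
Context {F : fieldType} {V : vectType F}.

Definition polar (n : V -> F) (x y : V) : F := n (x + y) - n x - n y.

End Polar.

(* In characteristic 2 a quadratic form may be called nondegenerate under a    *)
(* weaker condition than the one on the polar form used here.                  *)
Record cayleyAlg (F : fieldType) := CayleyAlg {
  cay_sort :> vectType F;
  cmul : {bilinear cay_sort -> cay_sort -> cay_sort};
  cone : cay_sort;
  cnorm : cay_sort -> F;
  dim_cay : \dim {:cay_sort} = 8%N;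
  cmul1x : left_id cone cmul;
  cmulx1 : right_id cone cmul;
  cnormZ : forall a x, cnorm (a *: x) = a ^+ 2 * cnorm x;
  cpolar_bilinear : bilinear_for *%R *%R (polar cnorm);
  cpolar_nondeg : forall x, (forall y, polar cnorm x y = 0) -> x = 0;
  cnormM : forall x y, cnorm (cmul x y) = cnorm x * cnorm y }.

Record invAlg (F : fieldType) := InvAlg {
  ia_sort :> vectType F;
  ia_mul : {bilinear ia_sort -> ia_sort -> ia_sort};
  ia_inv : {linear ia_sort -> ia_sort};
  ia_invK : involutive ia_inv;
  ia_invM : forall x y, ia_inv (ia_mul x y) = ia_mul (ia_inv y) (ia_inv x) }.

(* The quotient V / U is realised on the complement U^C, the class of v being  *)
(* its component in U^C along U.                                               *)
Section QuotientSpace.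
Context {F : fieldType} {V : vectType F} (U : {vspace V}).

Definition vquot : vectType F := subvs_of (U^C)%VS.

Definition vclass (v : V) : vquot := vsproj (U^C)%VS (v - projv U v).

Fact vclass_is_linear : linear vclass.
Proof.
move=> a u v; rewrite /vclass -linearP; congr (vsproj _ _).
by rewrite linearP scalerBr opprD addrACA.
Qed.
HB.instance Definition _ := GRing.isLinear.Build F V vquot _ vclass vclass_is_linear.

Lemma val_vclass v : val (vclass v) = v - projv U v.
Proof. by rewrite /= vsprojK // memv_projC. Qed.

Lemma vclass_eq0 v : (vclass v == 0) = (v \in U).
Proof.
rewrite -val_eqE val_vclass /= subr_eq0.
by apply/eqP/idP => [-> | /projv_id//]; apply: memv_proj.
Qed.

Lemma vclass_valK (w : vquot) : vclass (val w) = w.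
Proof.
apply/val_inj; rewrite val_vclass; suff -> : projv U (val w) = 0 by rewrite subr0.
by apply/eqP; rewrite -memv_ker lker_proj subvsP.
Qed.

End QuotientSpace.

Section Tensor.
Context {F : fieldType} {V : vectType F}.

Local Notation d := (\dim {:V}).
Local Notation e i := ((vbasis {:V})`_i).

(* V (x) V as the space of coordinate matrices in the basis e_i (x) e_j.       *)
Definition tensor : vectType F := 'M[F]_d.

Definition tens (u v : V) : tensor :=
  \matrix_(i, j) (coord (vbasis {:V}) i u * coord (vbasis {:V}) j v).

Fact tens_is_bilinear : bilinear_for *:%R *:%R tens.
Proof.
by split=> [v a x y | u a x y]; apply/matrixP => i j; rewrite !mxE linearP /=;
  [rewrite mulrDl mulrA | rewrite mulrDr mulrCA].
Qed.
HB.instance Definition _ :=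
  bilinear_isBilinear.Build F V V tensor _ _ tens tens_is_bilinear.

(* The linear map on V (x) V attached to a bilinear f, by its values on the    *)
(* basis.                                                                      *)
Definition tlift (W : vectType F) (f : V -> V -> W) (A : tensor) : W :=
  \sum_i \sum_j A i j *: f (e i) (e j).

Section Tlift.
Variable W : vectType F.

Fact tlift_is_linear (f : V -> V -> W) : linear (tlift f).
Proof.
move=> a A B; rewrite /tlift scaler_sumr -big_split; apply: eq_bigr => i _ /=.
rewrite scaler_sumr -big_split; apply: eq_bigr => j _ /=.
by rewrite !mxE scalerDl scalerA.
Qed.
HB.instance Definition _ f :=
  GRing.isLinear.Build F tensor W _ (tlift f) (tlift_is_linear f).

Lemma tliftE (f : V -> V -> W) u v :
  bilinear_for *:%R *:%R f -> tlift f (tens u v) = f u v.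
Proof.
move=> [fl fr].
pose g : {bilinear V -> V -> W} :=
  HB.pack f (bilinear_isBilinear.Build F V V W _ _ f (fl, fr)).
rewrite [in RHS](coord_vbasis (memvf u)) -[f]/(g : _ -> _ -> _).
rewrite linear_sumlz; apply: eq_bigr => i _; rewrite linearZl_LR.
rewrite [in RHS](coord_vbasis (memvf v)) linear_sumr scaler_sumr.
by apply: eq_bigr => j _; rewrite linearZr scalerA mxE.
Qed.

End Tlift.
End Tensor.
Arguments tensor {F} V.

(* S^2(V) = (V (x) V) / M with M = span {x (x) y - y (x) x}; by bilinearity it *)
(* is enough to let x and y run through a basis.                               *)
Section SymSquare.
Context {F : fieldType} {V : vectType F}.

Definition alt_tens : {vspace tensor V} :=
  <<[seq tens x y - tens y x | x <- vbasis {:V}, y <- vbasis {:V}]>>%VS.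

Lemma alt_tensP (x y : V) : tens x y - tens y x \in alt_tens.
Proof.
rewrite (coord_vbasis (memvf x)) (coord_vbasis (memvf y)).
rewrite linear_sumlz linear_sumr -sumrB; apply: rpred_sum => i _.
rewrite linearZl_LR linearZr_LR -scalerBr; apply: rpredZ.
rewrite linear_sumlz linear_sumr -sumrB; apply: rpred_sum => j _.
rewrite linearZl_LR linearZr_LR -scalerBr; apply: rpredZ.
by apply/memv_span/allpairsP; exists ((vbasis {:V})`_i, (vbasis {:V})`_j);
  rewrite !mem_nth ?size_tuple.
Qed.

Definition symsq : vectType F := vquot alt_tens.

Definition sprod (x y : V) : symsq := vclass alt_tens (tens x y).

Fact sprod_is_bilinear : bilinear_for *:%R *:%R sprod.
Proof.
by split=> [v a x y | u a x y]; rewrite /sprod ?linearPl ?linearPr linearP.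
Qed.
HB.instance Definition _ :=
  bilinear_isBilinear.Build F V V symsq _ _ sprod sprod_is_bilinear.

Lemma sprodC x y : sprod x y = sprod y x.
Proof.
by apply/eqP; rewrite -subr_eq0 -linearB vclass_eq0 alt_tensP.
Qed.

(* The linear map on S^2(V) attached to a symmetric bilinear f.                *)
Definition slift (W : vectType F) (f : V -> V -> W) (h : symsq) : W :=
  tlift f (val h).

Lemma sliftE (W : vectType F) (f : V -> V -> W) x y :
  bilinear_for *:%R *:%R f -> (forall u v, f u v = f v u) ->
  slift f (sprod x y) = f x y.
Proof.
move=> bf fC; rewrite /slift /sprod val_vclass linearB /= (tliftE _ _ bf).
suff -> : tlift f (projv alt_tens (tens x y)) = 0 by rewrite subr0.
have : (alt_tens <= lker (linfun (tlift f)))%VS.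
  apply/span_subvP => _ /allpairsP[[u v] [_ _ ->]] /=.
  by rewrite memv_ker lfunE /= linearB /= !(tliftE _ _ bf) fC subrr.
move/subvP/(_ _ (memv_proj _ (tens x y))).
by rewrite memv_ker lfunE => /eqP.
Qed.

End SymSquare.
Arguments symsq {F} V.

Section LinearClosure.
Context {F : fieldType} {U V W : lmodType F}.

Fact lin_add (f g : U -> V) : linear f -> linear g -> linear (fun x => f x + g x).
Proof. by move=> fl gl a x y; rewrite fl gl scalerDr addrACA. Qed.

Fact lin_scale k (f : U -> V) : linear f -> linear (fun x => k *: f x).
Proof. by move=> fl a x y; rewrite fl scalerDr !scalerA mulrC. Qed.

Fact lin_opp (f : U -> V) : linear f -> linear (fun x => - f x).
Proof. by move=> fl a x y; rewrite fl opprD scalerN. Qed.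

Fact lin_scal (f : U -> F) w : scalar f -> linear (fun x => f x *: w : V).
Proof. by move=> fl a x y; rewrite fl scalerDl scalerA. Qed.

Fact lin_comp (f : V -> W) (g : U -> V) :
  linear f -> linear g -> linear (fun x => f (g x)).
Proof. by move=> fl gl a x y; rewrite gl fl. Qed.

Fact linfun0 (f : U -> V) : linear f -> f 0 = 0.
Proof. by move=> /(_ (-1) 0 0); rewrite scaler0 addr0 scaleN1r addNr. Qed.

Fact linN (f : U -> V) x : linear f -> f (- x) = - f x.
Proof.
by move=> fl; have := fl (-1) x 0; rewrite linfun0 // !addr0 !scaleN1r.
Qed.

Fact lin_pair (f : U -> V) (g : U -> W) :
  linear f -> linear g -> linear (fun x => (f x, g x)).
Proof. by move=> fl gl a x y; rewrite fl gl. Qed.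

End LinearClosure.

Section SliftTheory.
Context {F : fieldType} {V W : vectType F}.
Implicit Types (f g : V -> V -> W) (h : symsq V).

Fact slift_is_linear f : linear (slift f).
Proof. by move=> a x y; rewrite /slift !linearP. Qed.
HB.instance Definition _ f :=
  GRing.isLinear.Build F (symsq V) W _ (slift f) (slift_is_linear f).

Lemma eq_slift f g h : (forall x y, f x y = g x y) -> slift f h = slift g h.
Proof.
by move=> fg; apply: eq_bigr => i _; apply: eq_bigr => j _; rewrite fg.
Qed.

Lemma slift0 f h : (forall x y, f x y = 0) -> slift f h = 0.
Proof.
by move=> f0; rewrite /slift /tlift big1 // => i _; rewrite big1 // => j _;
  rewrite f0 scaler0.
Qed.

Lemma sliftN f h : slift (fun x y => - f x y) h = - slift f h.
Proof.
rewrite /slift /tlift -sumrN; apply: eq_bigr => i _.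
by rewrite -sumrN; apply: eq_bigr => j _; rewrite scalerN.
Qed.

Fact slift_fun_linear (U : lmodType F) (f : U -> V -> V -> W) h :
  (forall x y, linear (fun u => f u x y)) -> linear (fun u => slift (f u) h).
Proof.
move=> fl a u v; rewrite /slift /tlift scaler_sumr -big_split.
apply: eq_bigr => i _ /=; rewrite scaler_sumr -big_split.
by apply: eq_bigr => j _ /=; rewrite fl scalerDr !scalerA mulrC.
Qed.

Fact slift_exch (f : V -> V -> V -> V -> W) h h' :
  slift (fun a b => slift (f a b) h') h =
  slift (fun c d => slift (fun a b => f a b c d) h) h'.
Proof.
rewrite /slift /tlift !pair_bigA /=.
under eq_bigr do rewrite pair_bigA scaler_sumr.
under [in RHS]eq_bigr do rewrite pair_bigA scaler_sumr.
rewrite exchange_big; apply: eq_bigr => q _; apply: eq_bigr => p _ /=.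
by rewrite !scalerA mulrC.
Qed.

End SliftTheory.

Section CayleySkew.
Context {F : fieldType} (C : cayleyAlg F).
Local Notation n := (polar (@cnorm F C)).

Definition cconj (x : C) : C := n x (cone C) *: cone C - x.

Definition ccomm (x y : C) : C := cmul C x y - cmul C y x.

Fact cconj_is_linear : linear cconj.
Proof.
apply: lin_add; last exact/lin_opp.
by apply: lin_scal; exact: (cpolar_bilinear C).1.
Qed.
HB.instance Definition _ := GRing.isLinear.Build F C C _ cconj cconj_is_linear.

Definition cskewv : {vspace C} := lker (linfun cconj + \1)%VF.

Lemma cskewvE x : (x \in cskewv) = (cconj x == - x).
Proof. by rewrite memv_ker add_lfunE !lfunE /= addr_eq0. Qed.

Definition cskew : vectType F := subvs_of cskewv.

Lemma polarC (x y : C) : n x y = n y x.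
Proof. by rewrite /polar [x + y]addrC addrAC. Qed.

Lemma polar_cmul1 (x y : C) :
  n (cmul C x y) (cone C) + n x y = n x (cone C) * n y (cone C).
Proof.
have [nl nr] := cpolar_bilinear C.
have nDl z : {morph n^~ z : u v / u + v}.
  by move=> u v; have := nl z 1 u v; rewrite scale1r /= mul1r.
have nDr z : {morph n z : u v / u + v}.
  by move=> u v; have := nr z 1 u v; rewrite scale1r /= mul1r.
have e u v z : n (cmul C u z) (cmul C v z) = n u v * cnorm z.
  by rewrite /polar -linearDl !cnormM !mulrBl.
have nD u v : cnorm (u + v) = n u v + cnorm u + cnorm v.
  by rewrite /polar; ring.
have := e x (cone C) (y + cone C).
rewrite !linearDr /= nDl !nDr !e !cmul1x !cmulx1 nD => eq1.
apply/eqP; rewrite -subr_eq0; apply/eqP.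
rewrite -[RHS](subrr (n x (cone C) * (n y (cone C) + cnorm y + cnorm (cone C)))).
rewrite -{1}eq1; ring.
Qed.

Lemma cskewv_comm x y : ccomm x y \in cskewv.
Proof.
have nl z := (cpolar_bilinear C).1 z (-1).
rewrite cskewvE /cconj; suff -> : n (ccomm x y) (cone C) = 0.
  by rewrite scale0r sub0r.
have := nl (cone C) (cmul C y x) (cmul C x y).
rewrite scaleN1r [- _ + _]addrC -/(ccomm x y) => ->; apply/eqP.
rewrite /= mulN1r addrC subr_eq0.
by rewrite -(inj_eq (addIr (n x y))) polar_cmul1 [n x y]polarC polar_cmul1 mulrC.
Qed.

Definition scomm (x y : cskew) : cskew := vsproj cskewv (ccomm (val x) (val y)).

Lemma val_scomm x y : val (scomm x y) = ccomm (val x) (val y).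
Proof. exact/vsprojK/cskewv_comm. Qed.

Lemma scommC x y : scomm x y = - scomm y x.
Proof. by apply: val_inj; rewrite linearN /= !val_scomm opprB. Qed.

Fact scomm_is_bilinear : bilinear_for *:%R *:%R scomm.
Proof.
split=> z; apply: (lin_comp (f := vsproj _) (linearP _)); apply: lin_add.
- by move=> a x y; rewrite linearP /= linearPl.
- by apply: lin_opp => a x y; rewrite !linearP.
- by move=> a x y; rewrite !linearP.
- by apply: lin_opp => a x y; rewrite linearP /= linearPl.
Qed.
HB.instance Definition _ :=
  bilinear_isBilinear.Build F cskew cskew cskew _ _ scomm scomm_is_bilinear.

Definition sform (x y : cskew) : F := n (val x) (val y).

Lemma sformC x y : sform x y = sform y x.
Proof. exact: polarC. Qed.

Fact sform_is_bilinear : bilinear_for *%R *%R sform.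
Proof.
have [nl nr] := cpolar_bilinear C.
by split=> [z a x y | z a x y]; rewrite /sform linearP /=; [exact: nl|exact: nr].
Qed.
HB.instance Definition _ :=
  bilinear_isBilinear.Build F cskew cskew F _ _ sform sform_is_bilinear.

End CayleySkew.

Section Smirnov.
Context {F : fieldType} (C : cayleyAlg F).

Local Notation S := (cskew C).
Local Notation H := (symsq S).
Local Notation n := (@sform F C).
Local Notation "⟦ x , y ⟧" := (@scomm F C x y) (at level 0).
Local Notation "x × y" := (@sprod F S x y) (at level 35).
Local Notation c4 := (4%:R^-1 : F).
Local Notation c2 := (2%:R^-1 : F).

Definition smirnov_sort : vectType F := (H * S)%type.

Definition dotSH (s s1 s2 : S) : S :=
  - (n s1 s2 *: s) - c2 *: (n s s1 *: s2 + n s s2 *: s1).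

Definition dotHH (s1 s2 s3 s4 : S) : H :=
  c4 *: (⟦s1, s3⟧ × ⟦s2, s4⟧ + ⟦s1, s4⟧ × ⟦s2, s3⟧)
  - n s1 s2 *: (s3 × s4) - n s3 s4 *: (s1 × s2).

Definition brkSH (s s1 s2 : S) : H := ⟦s, s1⟧ × s2 + s1 × ⟦s, s2⟧.

Definition brkHH (s1 s2 s3 s4 : S) : S :=
  - (c2 *: (n s1 s3 *: ⟦s2, s4⟧ + n s1 s4 *: ⟦s2, s3⟧
            + n s2 s3 *: ⟦s1, s4⟧ + n s2 s4 *: ⟦s1, s3⟧)).

(* The products involving H are given on generators s1 × s2 and extended by    *)
(* slift; smirnov_dotSS, ..., smirnov_brkHH check that the extensions take the *)
(* prescribed values for all arguments, not only on a basis of S.              *)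
Definition smirnov_dot (x y : smirnov_sort) : smirnov_sort :=
  (x.2 × y.2 + slift (fun s1 s2 => slift (dotHH s1 s2) y.1) x.1,
   slift (dotSH x.2) y.1 + slift (dotSH y.2) x.1).

Definition smirnov_brk (x y : smirnov_sort) : smirnov_sort :=
  (slift (brkSH x.2) y.1 - slift (brkSH y.2) x.1,
   ⟦x.2, y.2⟧ + slift (fun s1 s2 => slift (brkHH s1 s2) y.1) x.1).

Definition smirnov_mul (x y : smirnov_sort) : smirnov_sort :=
  smirnov_dot x y + c2 *: smirnov_brk x y.

Definition smirnov_inv (x : smirnov_sort) : smirnov_sort := (x.1, - x.2).

Local Ltac lin := repeat first
  [ exact: (linearPl (@sprod F S)) | exact: (linearPr (@sprod F S))
  | exact: (linearPl (@scomm F C)) | exact: (linearPr (@scomm F C))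
  | by move=> ? ? ?
  | apply: lin_add | apply: lin_opp | apply: lin_scale
  | (apply: lin_scal;
      first [exact: (sform_is_bilinear C).1 | exact: (sform_is_bilinear C).2])
  | apply: (lin_comp (f := fun z => z × _))
  | apply: (lin_comp (f := fun z => _ × z)) ].

Fact dotSH_bilinear s : bilinear_for *:%R *:%R (dotSH s).
Proof. by split=> z; rewrite /dotSH; lin. Qed.

Fact dotSH_linear s1 s2 : linear (fun s => dotSH s s1 s2).
Proof. by rewrite /dotSH; lin. Qed.

Fact dotSH_sym s s1 s2 : dotSH s s1 s2 = dotSH s s2 s1.
Proof. by rewrite /dotSH sformC [X in c2 *: X]addrC. Qed.

Fact dotHH_bilinear s1 s2 : bilinear_for *:%R *:%R (dotHH s1 s2).
Proof. by split=> z; rewrite /dotHH; lin. Qed.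

Fact dotHH_swap s1 s2 s3 s4 : dotHH s1 s2 s3 s4 = dotHH s3 s4 s1 s2.
Proof.
have cc a b c d : ⟦a, b⟧ × ⟦c, d⟧ = ⟦b, a⟧ × ⟦d, c⟧.
  by rewrite (scommC a) (scommC c) linearNl linearNr opprK.
rewrite /dotHH (cc s1 s3) (cc s1 s4) [⟦s4, s1⟧ × _]sprodC.
by rewrite -!addrA; congr (_ + _); rewrite addrC.
Qed.

Fact dotHH_sym s1 s2 s3 s4 : dotHH s1 s2 s3 s4 = dotHH s1 s2 s4 s3.
Proof.
by rewrite /dotHH addrC [X in c4 *: X]addrC addrC [n s3 s4]sformC [s3 × s4]sprodC.
Qed.

Fact brkSH_bilinear s : bilinear_for *:%R *:%R (brkSH s).
Proof. by split=> z; rewrite /brkSH; lin. Qed.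

Fact brkSH_linear s1 s2 : linear (fun s => brkSH s s1 s2).
Proof. by rewrite /brkSH; lin. Qed.

Fact brkSH_sym s s1 s2 : brkSH s s1 s2 = brkSH s s2 s1.
Proof. by rewrite /brkSH addrC ![_ × ⟦s, _⟧]sprodC. Qed.

Fact brkHH_bilinear s1 s2 : bilinear_for *:%R *:%R (brkHH s1 s2).
Proof. by split=> z; rewrite /brkHH; lin. Qed.

Fact brkHH_swap s1 s2 s3 s4 : brkHH s1 s2 s3 s4 = - brkHH s3 s4 s1 s2.
Proof.
rewrite /brkHH opprK -scalerN; congr (c2 *: _).
rewrite !opprD -!scalerN -!scommC (sformC s3 s1) (sformC s3 s2) (sformC s4 s1).
by rewrite (sformC s4 s2) -!addrA; congr (_ + _); rewrite addrCA.
Qed.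

Fact brkHH_sym s1 s2 s3 s4 : brkHH s1 s2 s3 s4 = brkHH s1 s2 s4 s3.
Proof. by rewrite /brkHH [X in X + _ + _]addrC -!addrA [X in _ + (_ + X)]addrC. Qed.

Fact slift_dotHHC h h' :
  slift (fun a b => slift (dotHH a b) h') h =
  slift (fun a b => slift (dotHH a b) h) h'.
Proof.
rewrite slift_exch; apply: eq_slift => a b; apply: eq_slift => c d.
exact: dotHH_swap.
Qed.

Fact slift_brkHHC h h' :
  slift (fun a b => slift (brkHH a b) h') h =
  - slift (fun a b => slift (brkHH a b) h) h'.
Proof.
rewrite slift_exch -!sliftN; apply: eq_slift => a b; rewrite -sliftN.
by apply: eq_slift => c d; apply: brkHH_swap.
Qed.

Lemma smirnov_dotC x y : smirnov_dot x y = smirnov_dot y x.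
Proof.
rewrite /smirnov_dot (sprodC x.2) (slift_dotHHC x.1).
by rewrite (addrC (slift (dotSH x.2) y.1)).
Qed.

Lemma smirnov_brkC x y : smirnov_brk x y = - smirnov_brk y x.
Proof.
rewrite /smirnov_brk (scommC x.2) (slift_brkHHC x.1) -opprD.
by rewrite -(opprB (slift (brkSH y.2) x.1)).
Qed.

Lemma smirnov_dotSS (s1 s2 : S) : smirnov_dot (0, s1) (0, s2) = (s1 × s2, 0).
Proof. by rewrite /smirnov_dot /= !linear0 !addr0. Qed.

Lemma smirnov_dotSH (s s1 s2 : S) :
  smirnov_dot (0, s) (s1 × s2, 0) = (0, dotSH s s1 s2).
Proof.
rewrite /smirnov_dot /= sliftE; [|exact: dotSH_bilinear|exact: dotSH_sym].
by rewrite linear0r !linear0 !addr0.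
Qed.

Lemma smirnov_dotHH (s1 s2 s3 s4 : S) :
  smirnov_dot (s1 × s2, 0) (s3 × s4, 0) = (dotHH s1 s2 s3 s4, 0).
Proof.
have slE a b : slift (dotHH a b) (s3 × s4) = dotHH s3 s4 a b.
  by rewrite sliftE ?(dotHH_swap a)//; [exact: dotHH_bilinear|exact: dotHH_sym].
rewrite /smirnov_dot /= (eq_slift _ slE) -(dotHH_swap s3).
rewrite sliftE; [|exact: dotHH_bilinear|exact: dotHH_sym].
by rewrite linear0r !(slift0 _ (fun a b => linfun0 (dotSH_linear a b))) !add0r.
Qed.

Lemma smirnov_brkSS (s1 s2 : S) : smirnov_brk (0, s1) (0, s2) = (0, ⟦s1, s2⟧).
Proof. by rewrite /smirnov_brk /= !linear0 !addr0. Qed.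

Lemma smirnov_brkSH (s s1 s2 : S) :
  smirnov_brk (0, s) (s1 × s2, 0) = (⟦s, s1⟧ × s2 + s1 × ⟦s, s2⟧, 0).
Proof.
rewrite /smirnov_brk /= sliftE; [|exact: brkSH_bilinear|exact: brkSH_sym].
by rewrite linear0r !linear0 !addr0.
Qed.

Lemma smirnov_brkHH (s1 s2 s3 s4 : S) :
  smirnov_brk (s1 × s2, 0) (s3 × s4, 0) = (0, brkHH s1 s2 s3 s4).
Proof.
have slE a b : slift (brkHH a b) (s3 × s4) = brkHH a b s3 s4.
  by rewrite sliftE; [|exact: brkHH_bilinear|exact: brkHH_sym].
rewrite /smirnov_brk /= (eq_slift _ slE) linear0r add0r.
rewrite !(slift0 _ (fun a b => linfun0 (brkSH_linear a b))) subr0 sliftE //.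
  split=> z; rewrite /brkHH; lin.
by move=> u v; rewrite ![brkHH _ _ s3 s4]brkHH_swap brkHH_sym.
Qed.

Fact smirnov_mul_bilinear : bilinear_for *:%R *:%R smirnov_mul.
Proof.
have dl y : linear (smirnov_dot ^~ y).
  apply: lin_pair; apply: lin_add.
  - by move=> a u v; rewrite linearPl.
  - by move=> a u v; rewrite linearP.
  - by apply: slift_fun_linear => s t a u v; apply: dotSH_linear.
  - by move=> a u v; rewrite linearP.
have bl y : linear (smirnov_brk ^~ y).
  apply: lin_pair; apply: lin_add.
  - by apply: slift_fun_linear => s t a u v; apply: brkSH_linear.
  - by apply: lin_opp => a u v; rewrite linearP.
  - by move=> a u v; rewrite linearPl.
  - by move=> a u v; rewrite linearP.
split=> y; apply: lin_add; rewrite ?/smirnov_mul.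
- exact: dl.
- exact/lin_scale/bl.
- by move=> a u v; rewrite !(smirnov_dotC y) dl.
- by apply: lin_scale => a u v; rewrite !(smirnov_brkC y) bl opprD scalerN.
Qed.
HB.instance Definition _ :=
  bilinear_isBilinear.Build F smirnov_sort smirnov_sort smirnov_sort _ _
    smirnov_mul smirnov_mul_bilinear.

Fact smirnov_inv_linear : linear smirnov_inv.
Proof.
by apply: lin_pair; [|apply: lin_opp] => a u v.
Qed.
HB.instance Definition _ :=
  GRing.isLinear.Build F smirnov_sort smirnov_sort _ smirnov_inv
    smirnov_inv_linear.

Fact smirnov_invK : involutive smirnov_inv.
Proof. by case=> h s; rewrite /smirnov_inv /= opprK. Qed.

Fact smirnov_invM x y :
  smirnov_inv (smirnov_mul x y) = smirnov_mul (smirnov_inv y) (smirnov_inv x).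
Proof.
have dE : smirnov_inv (smirnov_dot x y) =
          smirnov_dot (smirnov_inv x) (smirnov_inv y).
  have e w h : slift (dotSH (- w)) h = - slift (dotSH w) h.
    exact: (@linN F S S (fun s => slift (dotSH s) h) w
              (slift_fun_linear _ dotSH_linear)).
  by rewrite /smirnov_inv /smirnov_dot /= linearNl linearNr opprK opprD (e x.2) (e y.2).
have bE : smirnov_inv (smirnov_brk x y) =
          - smirnov_brk (smirnov_inv x) (smirnov_inv y).
  rewrite /smirnov_inv /smirnov_brk /= linearNl linearNr opprK.
  have e w h : slift (brkSH (- w)) h = - slift (brkSH w) h.
    exact: (@linN F S H (fun s => slift (brkSH s) h) w
              (slift_fun_linear _ brkSH_linear)).
  by rewrite (e x.2) (e y.2) -opprD; congr pair; rewrite opprK.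
rewrite /smirnov_mul linearD linearZ /= dE bE smirnov_dotC.
by rewrite [in RHS]smirnov_brkC.
Qed.

Definition smirnov : invAlg F :=
  @InvAlg F smirnov_sort smirnov_mul smirnov_inv smirnov_invK smirnov_invM.

End Smirnov.

Section Gradings.
Context {F : fieldType} {A : invAlg F}.

(* As A has finite dimension, a direct sum decomposition indexed by G has only *)
(* finitely many nonzero components; gsupp lists the support.                  *)
Record grading (G : zmodType) := Grading {
  gcomp :> G -> {vspace A};
  gsupp : seq G;
  gsupp_uniq : uniq gsupp;
  mem_gsupp : forall g, (g \in gsupp) = (gcomp g != 0%VS);
  gcomp_full : (\sum_(g : seq_sub gsupp) gcomp (val g) = fullv)%VS;
  gcomp_direct : directv (\sum_(g : seq_sub gsupp) gcomp (val g));
  gcompM : forall g h x y,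
    x \in gcomp g -> y \in gcomp h -> ia_mul A x y \in gcomp (g + h);
  gcomp_inv : forall g x, x \in gcomp g -> ia_inv A x \in gcomp g }.

Definition ia_aut (f : 'End(A)) : Prop :=
  [/\ bijective f, {morph f : x y / ia_mul A x y}
    & {morph f : x / ia_inv A x}].

Definition equivalent (G G' : zmodType)
    (Gam : grading G) (Gam' : grading G') : Prop :=
  exists (f : 'End(A)) (alpha : G -> G'),
    [/\ ia_aut f,
        perm_eq (map alpha (gsupp Gam)) (gsupp Gam')
      & {in gsupp Gam, forall g, (f @: Gam g)%VS = Gam' (alpha g)}].

Definition refinement (G G' : zmodType)
    (Gam : grading G) (Gam' : grading G') : Prop :=
  forall g', exists g, (Gam' g' <= Gam g)%VS.

(* Only nonzero components matter: the zero ones are not part of the           *)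
(* decomposition.                                                              *)
Definition proper_refinement (G G' : zmodType)
    (Gam : grading G) (Gam' : grading G') : Prop :=
  refinement Gam Gam' /\
  exists g' g, [/\ g' \in gsupp Gam', (Gam' g' <= Gam g)%VS & Gam' g' != Gam g].

Definition fine (G : zmodType) (Gam : grading G) : Prop :=
  ~ exists (G' : zmodType) (Gam' : grading G'), proper_refinement Gam Gam'.

Section UniversalGroup.
Context {G : zmodType} (Gam : grading G).

Definition usupp : finType := seq_sub (gsupp Gam).

(* The free abelian group on the support.                                      *)
Definition ufree : zmodType := {ffun usupp -> int}.

Definition ugen (g : usupp) : ufree := [ffun x => (x == g)%:R].

(* 0 <> A_g A_h and A_g A_h is contained in A_k.                               *)
Definition urel (g h k : usupp) : Prop :=
  (exists x y, [/\ x \in Gam (val g), y \in Gam (val h) & ia_mul A x y != 0]) /\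
  (forall x y, x \in Gam (val g) -> y \in Gam (val h) ->
     ia_mul A x y \in Gam (val k)).

Inductive in_urels : ufree -> Prop :=
| in_urels0 : in_urels 0
| in_urelsB u v : in_urels u -> in_urels v -> in_urels (u - v)
| in_urelsG g h k : urel g h k -> in_urels (ugen g + ugen h - ugen k).

Definition urels : {pred ufree} := fun u => `[< in_urels u >].

Fact urels_zmod_closed : zmod_closed urels.
Proof.
split=> [|u v]; first exact/asboolP/in_urels0.
by move=> /asboolP u_in /asboolP v_in; apply/asboolP/in_urelsB.
Qed.
HB.instance Definition _ :=
  GRing.isZmodClosed.Build ufree urels urels_zmod_closed.

Definition universal_group : zmodType := Quotient.quot urels.

End UniversalGroup.
End Gradings.
Arguments grading {F} A G.

Definition zmod_isomorphic (U V : zmodType) : Prop :=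
  exists f : {additive U -> V}, bijective f.

(* Main.v *)
(* A grading of T(C) is determined by the induced grading of S: the products of
   S with H force the norm form and the commutator of S to be homogeneous, and H
   is spanned by the s x t. If S_0 <> 0, it contains w with w w = 1; the (+1)-
   and (-1)-eigenspaces of [w, _] / 2 are graded isotropic spaces in duality, and
   homogeneous x_0, x_1, x_2 in the first with n(x_0 x_1, x_2) <> 0 produce a
   homogeneous Cartan basis. If S_0 = 0, then [x, y] = 0 for any x, y in opposite
   degrees, and if moreover n(x, y) <> 0 this makes y a multiple of x; hence all
   degrees have order 2, all components of S are lines, and three of them
   generate a homogeneous basis of octonion units. So every grading is a
   coarsening of one of the two gradings given by such bases, whose degrees
   satisfy no other relations than those imposed by the products. *)

From HB Require Import structures.
From mathcomp Require Import ssrAC.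
Require Import Defs.
From mathcomp Require Import all_boot all_order all_algebra.
From mathcomp Require Import generic_quotient ring_quotient sesquilinear.
From mathcomp Require Import boolp ring.

Set Implicit Arguments.
Unset Strict Implicit.
Unset Printing Implicit Defensive.

Import GRing.Theory.
Local Open Scope ring_scope.

(** * Composition algebra identities and the cross product *)

(** Both cases are run through one notion: a [table] records the products, the form and the duality
    of a basis of S. The construction of the grading, automorphisms, fineness and universal groups
    are then settled for an arbitrary table. Only two things depend on the case: the existence of a
    homogeneous frame, and the fact that a degree function on the seven indices is universal for the
    relations [compat]. The products of T(C) are written in the cross product and the form alone, so
    two frames with the same table differ by an automorphism; this gives uniqueness up to
    equivalence. Universality also gives fineness: if the seven degrees are distinct, a refinement
    still has the frame homogeneous, so it is at the same time a coarsening. All divisions are by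
    powers of 2, so characteristic 3 needs no separate treatment. *)

Section CayleyIdentities.
Context {F : fieldType} (C : cayleyAlg F).
Local Notation n := (polar (@cnorm F C)).
Local Notation "x · y" := (cmul C x y) (at level 40, left associativity).
Local Notation one := (cone C).

HB.instance Definition _ :=
  bilinear_isBilinear.Build F C C F _ _ n (cpolar_bilinear C).

Lemma cnormD (x y : C) : cnorm (x + y) = n x y + cnorm x + cnorm y.
Proof. by rewrite /polar; ring. Qed.

Lemma polar_diag (x : C) : n x x = 2%:R * cnorm x.
Proof.
rewrite /polar -mulr2n -scaler_nat cnormZ; ring.
Qed.

(** n(1) is idempotent; were it 0, then n(x) = n(1 x) = 0 for every x, against nondegeneracy. *)
Lemma cnorm1 : (2%:R : F) != 0 -> cnorm one = 1.
Proof.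
move=> nz2; have := cnormM one one; rewrite cmul1x => /eqP.
rewrite -subr_eq0 -{1}[cnorm one]mulr1 -mulrBr mulf_eq0 subr_eq0.
case/orP => [/eqP c0|/eqP <-//].
have n0 (x y : C) : n x y = 0.
  have e (z : C) : cnorm z = 0 by have := cnormM one z; rewrite cmul1x c0 mul0r.
  by rewrite /polar !e !subr0.
have all0 (x : C) : x = 0 by apply: cpolar_nondeg => y; apply: n0.
have : {:C}%VS == 0%VS.
  by rewrite -subv0; apply/subvP => x _; rewrite (all0 x) mem0v.
by rewrite -dimv_eq0 dim_cay.
Qed.

(** Polarization of n(xy) = n(x) n(y) in both factors. The identities of C below follow from it and
    nondegeneracy. *)
Lemma polarMM (x y z w : C) :
  n (x · y) (z · w) + n (z · y) (x · w) = n x z * n y w.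
Proof.
have e u v t : n (u · t) (v · t) = n u v * cnorm t.
  by rewrite /polar -linearDl !cnormM !mulrBl.
have := e x z (y + w); rewrite !linearDr !linearDl /= !e cnormD => /eqP.
rewrite -subr_eq0 => /eqP eq0; apply/eqP; rewrite -subr_eq0; apply/eqP.
by rewrite -[RHS]eq0 (polarC (z · y)); ring.
Qed.

Lemma cmul_adjr (x y z : C) : n y one = 0 -> n (x · y) z = - n x (z · y).
Proof.
move=> y1; have := polarMM x y z one; rewrite !cmulx1 y1 mulr0 => /eqP.
by rewrite addr_eq0 (polarC x) => /eqP.
Qed.

Lemma polar_inj (x y : C) : (forall z, n x z = n y z) -> x = y.
Proof.
move=> e; apply/eqP; rewrite -subr_eq0; apply/eqP/cpolar_nondeg => z.
by rewrite linearBl /= e subrr.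
Qed.

(** The linearized right alternative law for trace-zero [x] and [z]: right multiplication by either
    is skew-adjoint, so pairing with any [w] reduces it to [polarMM]. *)
Lemma cmulKr (x y z : C) : n x one = 0 -> n z one = 0 ->
  (y · x) · z + (y · z) · x = - (n x z *: y).
Proof.
move=> x1 z1; apply: polar_inj => w.
rewrite linearDl /= (cmul_adjr (y · x) _ z1) (cmul_adjr (y · z) _ x1).
rewrite linearNl linearZl_LR /=.
by rewrite -opprD (polarC (y · z)) polarMM mulrC.
Qed.

Lemma cmul_anticomm (x y : C) : n x one = 0 -> n y one = 0 ->
  x · y + y · x = - (n x y *: one).
Proof. by move=> x1 y1; have := cmulKr one x1 y1; rewrite !cmul1x. Qed.

Lemma mem_cskewv (x : C) : (2%:R : F) != 0 -> (x \in cskewv C) = (n x one == 0).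
Proof.
move=> nz2; rewrite cskewvE /cconj -subr_eq0 opprK subrK scaler_eq0.
case: eqP => //= _; apply/negP => /eqP e1.
have := cnorm1 nz2; rewrite e1 -(scale0r 0) cnormZ expr0n mul0r => /esym/eqP.
by rewrite oner_eq0.
Qed.

End CayleyIdentities.

Section CrossProduct.
Context {F : fieldType} (C : cayleyAlg F).
Hypothesis nz2 : (2%:R : F) != 0.
Local Notation S := (cskew C).
Local Notation c2 := (2%:R^-1 : F).

Fact halved_key : unit. Proof. by []. Qed.
(* [x, y] / 2 and n(x, y) / 2, so that x y = cross x y - dotp x y 1 in C. They
   are locked: matching modulo conversion would otherwise unfold them into
   scalar multiples. *)
Definition cross : S -> S -> S :=
  locked_with halved_key (fun x y => c2 *: scomm x y).
Definition dotp : S -> S -> F :=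
  locked_with halved_key (fun x y => c2 * sform x y).

Lemma crossE x y : cross x y = c2 *: scomm x y.
Proof. by rewrite [cross]unlock. Qed.

Lemma dotpE x y : dotp x y = c2 * sform x y.
Proof. by rewrite [dotp]unlock. Qed.

Fact cross_is_bilinear : bilinear_for *:%R *:%R cross.
Proof.
by split=> [z a x y | z a x y]; rewrite !crossE ?linearPl ?linearPr scalerDr
  scalerA mulrC -scalerA.
Qed.
HB.instance Definition _ :=
  bilinear_isBilinear.Build F S S S _ _ cross cross_is_bilinear.

Fact dotp_is_bilinear : bilinear_for *%R *%R dotp.
Proof.
by split=> [z a x y | z a x y]; rewrite !dotpE ?linearPl ?linearPr /=; ring.
Qed.
HB.instance Definition _ :=
  bilinear_isBilinear.Build F S S F _ _ dotp dotp_is_bilinear.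

Local Notation m := cross.
Local Notation b := dotp.
Local Notation n := (polar (@cnorm F C)).
Local Notation "x · y" := (cmul C x y) (at level 40, left associativity).
Local Notation one := (cone C).

Lemma half2 : c2 + c2 = 1.
Proof. by rewrite -mulr2n -[_ *+ 2]mulr_natl divff. Qed.

Lemma sformE x y : sform x y = 2%:R * b x y.
Proof. by rewrite !dotpE mulrA divff // mul1r. Qed.

Lemma crossC x y : m x y = - m y x.
Proof. by rewrite !crossE scommC scalerN. Qed.

Lemma dotpC x y : b x y = b y x.
Proof. by rewrite !dotpE sformC. Qed.

Lemma self_oppr_eq0 (V : lmodType F) (x : V) : x = - x -> x = 0.
Proof.
move/eqP; rewrite -subr_eq0 opprK -mulr2n -scaler_nat scaler_eq0.
by rewrite (negPf nz2) => /eqP.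
Qed.

Lemma crossxx x : m x x = 0.
Proof. exact/self_oppr_eq0/crossC. Qed.

Lemma cskew1 (x : S) : n (val x) one = 0.
Proof. by apply/eqP; rewrite -mem_cskewv // subvsP. Qed.

Lemma val_cross x y : val (m x y) = val x · val y + b x y *: one.
Proof.
rewrite crossE linearZ /= val_scomm /ccomm.
have -> : val y · val x = - (val x · val y) - n (val x) (val y) *: one.
  by rewrite -cmul_anticomm ?cskew1 // addrA addNr add0r.
rewrite opprB opprK [_ *: one + _]addrC addrA scalerDr scalerDr -scalerDl half2.
by rewrite scale1r !dotpE scalerA.
Qed.

Lemma dotp_cross x y z : b (m x y) z = b x (m y z).
Proof.
have e u v w : sform (m u v) w = n (val u · val v) (val w).
  rewrite /sform val_cross linearDl linearZl_LR /= (polarC one) (cskew1 w).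
  by rewrite mulr0 addr0.
rewrite !dotpE e (sformC x) e (cmul_adjr _ _ (cskew1 y)) polarC; congr (_ * _).
have := cmul_anticomm (cskew1 y) (cskew1 z) => /eqP; rewrite addrC -subr_eq0 opprK.
rewrite -addrA addr_eq0 => /eqP ->; rewrite linearNl opprK linearDl /= linearZl_LR /=.
by rewrite (polarC one) (cskew1 x) mulr0 addr0.
Qed.

(** This is [cmulKr] restricted to S. Both multiplication tables below are derived from it,
    skew-symmetry and [dotp_cross]. *)
Lemma crossA x y z :
  m (m x y) z + m (m x z) y = - (2%:R * b y z) *: x + b x y *: z + b x z *: y.
Proof.
apply: val_inj; rewrite -[LHS]/(val (m (m x y) z) + val (m (m x z) y)).
rewrite -[RHS]/(- (2%:R * b y z) *: val x + b x y *: val z + b x z *: val y).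
rewrite !val_cross !linearDl /= !linearZl_LR /=.
rewrite !cmul1x dotp_cross [b (m x z) y]dotp_cross [m z y]crossC linearNr /=.
have -> : 2%:R * b y z = n (val y) (val z) by rewrite -sformE.
rewrite !scaleNr; have /= <- := cmulKr (val x) (cskew1 y) (cskew1 z).
by rewrite addrACA subrr addr0 addrACA addrA.
Qed.

End CrossProduct.

Section CrossProductTheory.
Context {F : fieldType} {C : cayleyAlg F}.
Hypothesis nz2 : (2%:R : F) != 0.
Local Notation S := (cskew C).
Local Notation m := (@cross F C).
Local Notation b := (@dotp F C).

(** S is orthogonal to 1, and subtracting n(y, 1) / 2 times 1 from [y] gives its part in S, so
    nondegeneracy passes from C to S. *)
Lemma dotp_nondeg (x : S) : (forall y, b x y = 0) -> x = 0.
Proof.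
move=> x0; apply: val_inj; apply: cpolar_nondeg => y.
pose k := 2%:R^-1 * polar (@cnorm F C) y (cone C).
have yS : y - k *: cone C \in cskewv C.
  rewrite mem_cskewv // linearBl linearZl_LR /= polar_diag cnorm1 // mulr1 /k.
  by rewrite mulrAC mulVf // mul1r subrr.
have := sformE nz2 x (vsproj (cskewv C) (y - k *: cone C)).
rewrite x0 mulr0 /sform /= vsprojK //.
by rewrite linearBr linearZr_LR /= (cskew1 nz2) mulr0 subr0.
Qed.

(** Rank-nullity: [cconj] plus the identity sends x to n(x, 1) 1, so its image is the line of 1. *)
Lemma dim_cskew : \dim {: S} = 7%N.
Proof.
rewrite dimvf -[dim _]/(\dim (cskewv C)).
have := limg_ker_dim (linfun (@cconj F C) + \1)%VF fullv.
rewrite capfv -/(cskewv C) dim_cay.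
suff -> : ((linfun (@cconj F C) + \1) @: fullv)%VS = <[cone C]>%VS.
  have one0 : cone C != 0.
    apply/eqP => e1; have := cnorm1 C nz2.
    by rewrite e1 -(scale0r 0) cnormZ expr0n mul0r => /esym/eqP; rewrite oner_eq0.
  by rewrite dim_vline one0 addn1 => -[].
have fE (x : C) : (linfun (@cconj F C) + \1)%VF x =
    polar (@cnorm F C) x (cone C) *: cone C.
  by rewrite add_lfunE lfunE id_lfunE /= /cconj subrK.
apply/vspaceP => x; apply/memv_imgP/vlineP => [[y _ ->]|[k ->]].
  by rewrite fE; eexists.
exists ((k / 2%:R) *: cone C); first exact: memvf.
by rewrite fE linearZl_LR /= polar_diag cnorm1 // mulr1 divfK.
Qed.

Lemma crossK (x y : S) : m (m x y) y = - b y y *: x + b x y *: y.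
Proof.
have e := crossA nz2 x y y; apply: (scalerI nz2).
rewrite scaler_nat mulr2n e scalerDr !scalerA mulrN -addrA -scalerDl.
by rewrite [in RHS]mulr_natl mulr2n.
Qed.

Lemma cross_swap (x y z : S) : b x y = 0 -> b x z = 0 -> b y z = 0 ->
  m (m x y) z = - m (m x z) y.
Proof.
move=> xy xz yz; apply/eqP; rewrite -addr_eq0 crossA // xy xz yz.
by rewrite mulr0 oppr0 !scale0r !addr0.
Qed.

Lemma dotp_crossl (x y : S) : b x (m x y) = 0.
Proof. by rewrite -dotp_cross // crossxx // linear0l. Qed.

Lemma dotp_crossr (x y : S) : b x (m y x) = 0.
Proof. by rewrite crossC linearNr /= dotp_crossl oppr0. Qed.

Lemma anisotropic_exists (x y : S) : b x y != 0 ->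
  [|| b x x != 0, b y y != 0 | b (x + y) (x + y) != 0].
Proof.
move=> xy; apply: contraT; rewrite !negb_or !negbK => /and3P[/eqP xx /eqP yy].
rewrite linearDl /= !linearDr /= xx yy add0r addr0 (dotpC y) -mulr2n -mulr_natl.
by rewrite mulf_eq0 (negPf nz2) (negPf xy).
Qed.

End CrossProductTheory.

Lemma sqrt_exists (F : closedFieldType) (c : F) : exists r : F, r ^+ 2 = c.
Proof.
have [r] := @solve_monicpoly F 2%N (fun i => if i == 0%N then c else 0) isT.
by rewrite !big_ord_recl big_ord0 /= expr0 mulr1 mul0r !addr0; exists r.
Qed.

Lemma dotp_scale (F : closedFieldType) (C : cayleyAlg F) (x : cskew C) (c : F) :
  dotp x x != 0 -> c != 0 -> exists2 k : F, k != 0 & dotp (k *: x) (k *: x) = c.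
Proof.
move=> xx c0; have [r r2] := sqrt_exists (c / dotp x x).
exists r; last by rewrite linearZl_LR linearZr_LR /= mulrA -expr2 r2 divfK.
apply: contraNneq c0 => r0; move: r2; rewrite r0 expr0n /= => /esym/eqP.
by rewrite mulf_eq0 invr_eq0 (negPf xx) orbF.
Qed.

(** * Frames: bases with a prescribed multiplication table *)

(* In a frame w, (x_i), (y_i) with i in Z/3, None stands for w, Some (i, false)
   for x_i and Some (i, true) for y_i. *)
Definition idx : finType := option ('I_3 * bool).

(* The table of a basis (e_i): e_i x e_j = tcoef i j e_(tprod i j), while
   dotp e_i e_j is tform i if j = tdual i and 0 otherwise. *)
Record table (F : fieldType) := Table {
  tcoef : idx -> idx -> F;
  tprod : idx -> idx -> idx;
  tform : idx -> F;
  tdual : idx -> idx;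
  tform_neq0 : forall i, tform i != 0;
  tdualK : involutive tdual }.

Section Frames.
Context {F : fieldType} {C : cayleyAlg F}.
Hypothesis nz2 : (2%:R : F) != 0.
Local Notation S := (cskew C).
Local Notation m := (@cross F C).
Local Notation b := (@dotp F C).

Definition is_frame (T : table F) (e : idx -> S) : Prop :=
  (forall i j, m (e i) (e j) = tcoef T i j *: e (tprod T i j)) /\
  (forall i j, b (e i) (e j) = if j == tdual T i then tform T i else 0).

Variables (T : table F) (e : idx -> S).
Hypothesis fe : is_frame T e.

Definition fcoord i (x : S) : F := (tform T i)^-1 * b (e (tdual T i)) x.

Fact fcoord_is_scalar i : scalar (fcoord i).
Proof. by move=> a x y; rewrite /fcoord linearPr /=; ring. Qed.
HB.instance Definition _ i :=
  GRing.isLinear.Build F S F _ (fcoord i) (fcoord_is_scalar i).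

Lemma fcoord_frame i j : fcoord i (e j) = (i == j)%:R.
Proof.
rewrite /fcoord dotpC fe.2 (inj_eq (can_inj (@tdualK F T))).
by case: eqP => [<-|]; rewrite ?mulr0 // mulVf ?tform_neq0.
Qed.

Lemma frame_neq0 i : e i != 0.
Proof.
apply/eqP => e0; have := fcoord_frame i i; rewrite e0 linear0 eqxx.
by move/esym/eqP; rewrite oner_eq0.
Qed.

Lemma card_idx : #|idx| = 7%N.
Proof. by rewrite card_option card_prod card_ord card_bool. Qed.

(** The functionals [fcoord] are dual to [e], so the seven vectors are independent, and dim S =
    7. *)
Lemma frame_expand x : x = \sum_i fcoord i x *: e i.
Proof.
pose X := [tuple e (enum_val i) | i < #|idx|].
have nthX (i : 'I_#|idx|) : X`_i = e (enum_val i) by rewrite -tnth_nth tnth_mktuple.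
have fX : free X.
  apply/freeP => k k0 i.
  have := congr1 (fcoord (enum_val i)) k0; rewrite linear0 linear_sum (bigD1 i) //=.
  rewrite linearZ /= nthX fcoord_frame eqxx mulr1 big1 ?addr0 // => j ji.
  rewrite linearZ /= nthX fcoord_frame (inj_eq enum_val_inj) eq_sym (negPf ji).
  by rewrite mulr0.
have bX : basis_of fullv X.
  by rewrite basisEfree fX subvf size_tuple dim_cskew // card_idx.
have := coord_basis bX (memvf x) => xE.
have cE (i : 'I_#|idx|) : coord X i x = fcoord (enum_val i) x.
  rewrite {2}xE linear_sum (bigD1 i) //=.
  rewrite linearZ /= nthX fcoord_frame eqxx mulr1 big1 ?addr0 // => j ji.
  rewrite linearZ /= nthX fcoord_frame (inj_eq enum_val_inj) eq_sym (negPf ji).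
  by rewrite mulr0.
rewrite {1}xE [RHS](reindex_onto enum_val enum_rank) => [|i _]; last exact: enum_rankK.
under [RHS]eq_bigl do rewrite enum_valK eqxx.
by apply: eq_bigr => i _; rewrite nthX cE.
Qed.

End Frames.

Section I3.
Implicit Types i j : 'I_3.

Lemma I3_cases i j : [\/ j = i, j = i + 1 | j = i + 1 + 1].
Proof.
by case: i j => [[|[|[|]]] // ?] [[|[|[|]]] // ?];
  (by constructor 1; apply: val_inj) || (by constructor 2; apply: val_inj)
  || (by constructor 3; apply: val_inj).
Qed.

Lemma I3_add3 i : i + 1 + 1 + 1 = i.
Proof. by apply: val_inj; case: i => [[|[|[|]]]]. Qed.

(** As 0 + 1 + 2 = 0 in Z/3, the index different from two distinct [i] and [j] is [- (i + j)], the
    form used by the tables. *)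
Lemma I3_third i : (- (i + (i + 1)) = i + 1 + 1) * (- (i + (i + 1 + 1)) = i + 1).
Proof. by split; apply: val_inj; case: i => [[|[|[|]]]]. Qed.

Lemma I3_neq i : ((i == i + 1) = false) * ((i == i + 1 + 1) = false)
  * ((i + 1 == i) = false) * ((i + 1 + 1 == i) = false)
  * ((i + 1 + 1 == i + 1) = false) * ((i + 1 == i + 1 + 1) = false).
Proof. by do ![split]; case: i => [[|[|[|]]]]. Qed.

End I3.

(** * The Cartan and octonion multiplication tables *)

Section Tables.
Variable F : fieldType.

(** For distinct indices, the sign of the permutation (i, j, -(i + j)). *)
Definition cyc_sign (i j : 'I_3) : F := if j == i + 1 then 1 else -1.

(** The split octonions in a basis adapted to the idempotents (1 + w) / 2 and (1 - w) / 2. The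
    normalization y_i = x_(i+1) x x_(i+2), dotp x_i y_i = 1 forces the factor 2 in the products of
    the y_i. *)
Definition cartan_coef (p q : idx) : F :=
  match p, q with
  | None, None => 0
  | None, Some (_, v) => if v then -1 else 1
  | Some (_, v), None => if v then 1 else -1
  | Some (i, u), Some (j, v) =>
    if i == j then (if u == v then 0 else if u then 1 else -1)
    else if u == v then cyc_sign i j * (if u then 2%:R else 1) else 0
  end.

Definition cartan_prod (p q : idx) : idx :=
  match p, q with
  | None, r | r, None => r
  | Some (i, u), Some (j, v) => if i == j then None else Some (- (i + j), ~~ u)
  end.

(** Cayley-Dickson doubling: the x_i are the imaginary units of a quaternion subalgebra, [None] is a
    unit c orthogonal to it, and y_i = x_i c. *)
Definition octonion_coef (p q : idx) : F :=
  match p, q with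
  | None, None => 0
  | None, Some (_, v) => if v then 1 else -1
  | Some (_, v), None => if v then -1 else 1
  | Some (i, u), Some (j, v) =>
    if i == j then (if u == v then 0 else if u then 1 else -1)
    else if u || v then - cyc_sign i j else cyc_sign i j
  end.

Definition octonion_prod (p q : idx) : idx :=
  match p, q with
  | None, None => None
  | None, Some (i, u) | Some (i, u), None => Some (i, ~~ u)
  | Some (i, u), Some (j, v) => if i == j then None else Some (- (i + j), u (+) v)
  end.

Definition cartan_form (p : idx) : F := if p is None then -1 else 1.

Definition cartan_dual (p : idx) : idx := omap (fun q => (q.1, ~~ q.2)) p.

Fact cartan_form_neq0 p : cartan_form p != 0.
Proof. by case: p => [q|] /=; rewrite ?oppr_eq0 oner_eq0. Qed.

Fact cartan_dualK : involutive cartan_dual.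
Proof. by case=> [[i u]|] //=; rewrite negbK. Qed.

Definition cartan_table :=
  @Table F cartan_coef cartan_prod cartan_form cartan_dual
    cartan_form_neq0 cartan_dualK.

Definition octonion_table :=
  @Table F octonion_coef octonion_prod (fun=> 1) id
    (fun=> oner_neq0 F) (fun=> erefl).

End Tables.

(** * Frames from a few generating vectors *)

Section Constructions.
Context {F : fieldType} {C : cayleyAlg F}.
Hypothesis nz2 : (2%:R : F) != 0.
Local Notation S := (cskew C).
Local Notation m := (@cross F C).
Local Notation b := (@dotp F C).

Definition mk_frame (w : S) (x y : 'I_3 -> S) (p : idx) : S :=
  match p with
  | None => w
  | Some (i, u) => if u then y i else x i
  end.

Section Eigenvectors.
Variable w : S.

(** [cross w] is skew-adjoint for [dotp], so its eigenspaces for nonzero eigenvalues are totally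
    isotropic. *)
Lemma eigen_dot0 s (u v : S) : s != 0 -> m w u = s *: u -> m w v = s *: v ->
  b u v = 0.
Proof.
move=> s0 wu wv; have : s * b u v = - (s * b u v).
  rewrite -[LHS](linearZl_LR (@dotp F C) v s u) -wu crossC // linearNl /=.
  by rewrite dotp_cross // wv linearZr_LR.
move/(self_oppr_eq0 nz2 (V := F^o))/eqP; rewrite mulf_eq0 (negPf s0) => /eqP//.
Qed.

Lemma eigen_dotw s (u : S) : s != 0 -> m w u = s *: u -> b w u = 0.
Proof.
move=> s0 wu; have := dotp_crossl nz2 w u; rewrite wu linearZr_LR /= => /eqP.
by rewrite mulf_eq0 (negPf s0) => /eqP.
Qed.

(** [u], [v], [w] are pairwise orthogonal, so the right-hand side of [crossA] vanishes. *)
Lemma eigen_cross s (u v : S) : s != 0 -> m w u = s *: u -> m w v = s *: v ->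
  m w (m u v) = - s *: m u v.
Proof.
move=> s0 wu wv; have := crossA nz2 u v w.
rewrite (eigen_dot0 s0 wu wv) (dotpC u) (dotpC v) (eigen_dotw s0 wu) (eigen_dotw s0 wv).
rewrite mulr0 oppr0 !scale0r !addr0 [m u w]crossC // wu linearNl linearZl_LR /=.
by move/eqP; rewrite subr_eq0 crossC // scaleNr => /eqP <-; rewrite opprK.
Qed.

(** With X = u x v + b(u, v) w, two instances of [crossA] evaluate (u x v) x w as X and as -X, so X
    = 0. *)
Lemma eigen_cross_opp (u v : S) : m w u = u -> m w v = - v -> m u v = - b u v *: w.
Proof.
move=> wu wv; have nz1 : (-1 : F) != 0 by rewrite oppr_eq0 oner_eq0.
have uw : b u w = 0 by rewrite dotpC (eigen_dotw (oner_neq0 F)) ?scale1r.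
have vw : b v w = 0 by rewrite dotpC (eigen_dotw nz1) ?scaleN1r.
have := crossA nz2 u v w; have := crossA nz2 v u w.
rewrite uw vw mulr0 oppr0 !scale0r !addr0 !add0r [m u w]crossC // [m v w]crossC //.
rewrite wu wv opprK linearNl [m v u]crossC // linearNl /= [b v u]dotpC => e1 e2.
apply/eqP; rewrite -subr_eq0; apply/eqP/(self_oppr_eq0 nz2).
have e3 : m u v + b u v *: w = m (m u v) w by rewrite -e2 addrC subrK.
by rewrite scaleNr opprK {1}e3 -e1 addrC subrK opprK.
Qed.

End Eigenvectors.

(** The other entries of the table follow from the eigenvalues of [cross w] and the cyclic symmetry
    of b(u x v, t). *)
Lemma cartan_frame (w : S) (x : 'I_3 -> S) :
  b w w = -1 -> (forall i, m w (x i) = x i) ->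
  b (m (x 0) (x (0 + 1))) (x (0 + 1 + 1)) = 1 ->
  is_frame (cartan_table F) (mk_frame w x (fun i => m (x (i + 1)) (x (i + 1 + 1)))).
Proof.
move=> ww wx x0; set y := fun i => _.
have cyc u v t : b (m u v) t = b (m v t) u by rewrite dotp_cross // dotpC.
have x1 i : b (m (x i) (x (i + 1))) (x (i + 1 + 1)) = 1.
  have [->|->|->] := I3_cases 0 i => //; first by rewrite -cyc I3_add3.
  by rewrite cyc !I3_add3.
have wx1 i : m w (x i) = 1 *: x i by rewrite scale1r.
have nz1 : (-1 : F) != 0 by rewrite oppr_eq0 oner_eq0.
have wy1 i : m w (y i) = -1 *: y i by apply: eigen_cross (oner_neq0 F) _ _.
have wy i : m w (y i) = - y i by rewrite wy1 scaleN1r.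
have xx i j : b (x i) (x j) = 0 by apply: eigen_dot0 (oner_neq0 F) _ _.
have yy i j : b (y i) (y j) = 0 by apply: eigen_dot0 nz1 _ _.
have bwx i : b w (x i) = 0 by apply: eigen_dotw (oner_neq0 F) _.
have bwy i : b w (y i) = 0 by apply: eigen_dotw nz1 _.
have xy i j : b (x i) (y j) = (i == j)%:R.
  have [->|->|->] := I3_cases i j; rewrite ?eqxx ?I3_neq /y ?I3_add3.
  - by rewrite -dotp_cross // x1.
  - exact: dotp_crossr.
  - exact: dotp_crossl.
have mxy i j : m (x i) (y j) = - (i == j)%:R *: w.
  by rewrite (eigen_cross_opp (wx i) (wy j)) xy.
have mxx i : m (x i) (x (i + 1)) = y (i + 1 + 1) by rewrite /y I3_add3.
(* In [crossA], one copy of x_(i+2) comes from w x x_(i+2) and the other from b(x_(i+1), y_(i+1))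
   x_(i+2). *)
have myy i : m (y i) (y (i + 1)) = 2%:R *: x (i + 1 + 1).
  have := crossA nz2 (x (i + 1)) (x (i + 1 + 1)) (y (i + 1)).
  rewrite mxy eqxx xy I3_neq xx xy eqxx mulr0 oppr0 !scale0r !add0r scale1r.
  rewrite scaleN1r linearNl /= wx => /eqP.
  by rewrite subr_eq -mulr2n -scaler_nat => /eqP.
split=> [[[i u]|] [[j v]|]|[[i u]|] [[j v]|]] /=.
- have mxx2 i' : m (x i') (x (i' + 1 + 1)) = - y (i' + 1).
    by rewrite crossC // -{2}(I3_add3 i') mxx I3_add3.
  have myy2 i' : m (y i') (y (i' + 1 + 1)) = - (2%:R *: x (i' + 1)).
    by rewrite crossC // -{2}(I3_add3 i') myy I3_add3.
  case: u v => [] [] /=.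
  + have [->|->|->] := I3_cases i j;
      rewrite ?eqxx ?I3_neq /cyc_sign ?I3_neq ?eqxx ?I3_third /=.
    * by rewrite crossxx // scale0r.
    * by rewrite mul1r.
    * by rewrite myy2 mulN1r scaleNr.
  + rewrite crossC // mxy eq_sym; case: eqP => _ /=; last first.
      by rewrite scaleNr !scale0r !oppr0.
    by rewrite scaleNr opprK.
  + by rewrite mxy; case: eqP => _ /=; rewrite ?scaleNr ?scale0r ?oppr0.
  + have [->|->|->] := I3_cases i j;
      rewrite ?eqxx ?I3_neq /cyc_sign ?I3_neq ?eqxx ?I3_third /=.
    * by rewrite crossxx // scale0r.
    * by rewrite mul1r scale1r.
    * by rewrite mxx2 mulr1 scaleN1r.
- by rewrite crossC //; case: u; rewrite ?wy ?wx ?opprK ?scale1r ?scaleN1r.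
- by case: v; rewrite ?wy ?wx ?scale1r ?scaleN1r.
- by rewrite crossxx // scale0r.
- rewrite (inj_eq (@Some_inj _)) xpair_eqE [j == i]eq_sym.
  case: u v => [] []; rewrite ?xx ?yy ?xy ?[b (y i) _]dotpC ?xy ?andbF // andbT.
  1,2: by rewrite 1?[j == i]eq_sym; case: eqP.
- by rewrite dotpC; case: u.
- by case: v.
- exact: ww.
Qed.

(** [p], [q] and [m p q] are imaginary quaternion units, and [c] doubles their algebra; [cross_swap]
    turns products with the y_i into products of the x_i. *)
Lemma octonion_frame (p q c : S) :
  b p p = 1 -> b q q = 1 -> b c c = 1 -> b p q = 0 ->
  b p c = 0 -> b q c = 0 -> b (m p q) c = 0 ->
  let x := fun i : 'I_3 => if i == 0 then p else if i == 0 + 1 then q else m p q in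
  is_frame (octonion_table F) (mk_frame c x (fun i => m (x i) c)).
Proof.
move=> pp qq cc pq pc qc pqc x; set y := fun i => m (x i) c.
have x0 : x 0 = p by [].
have x1 : x (0 + 1) = q by [].
have x2 : x (0 + 1 + 1) = m p q by [].
have qpq : m q (m p q) = p.
  by rewrite crossC // crossK // qq pq scale0r addr0 scaleN1r opprK.
have pqp : m (m p q) p = q.
  rewrite [m p q]crossC // linearNl /= crossK // pp [b q p]dotpC pq scale0r addr0.
  by rewrite scaleN1r opprK.
have mxx i : m (x i) (x (i + 1)) = x (i + 1 + 1).
  by have [->|->|->] := I3_cases 0 i; rewrite ?I3_add3 ?x0 ?x1 ?x2.
have xx i j : b (x i) (x j) = (i == j)%:R.
  have xi : b (x i) (x i) = 1.
    have [->|->|->] := I3_cases 0 i; rewrite ?x0 ?x1 ?x2 //.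
    by rewrite dotp_cross // qpq.
  have xi1 k : b (x k) (x (k + 1)) = 0.
    have [->|->|->] := I3_cases 0 k; rewrite ?I3_add3 ?x0 ?x1 ?x2 //.
      exact: dotp_crossr.
    by rewrite dotpC dotp_crossl.
  have [->|->|->] := I3_cases i j; rewrite ?eqxx ?I3_neq //.
  by rewrite dotpC -{2}(I3_add3 i) xi1.
have xc i : b (x i) c = 0.
  by have [->|->|->] := I3_cases 0 i; rewrite ?x0 ?x1 ?x2.
have cx i : b c (x i) = 0 by rewrite dotpC.
have mcx i : m c (x i) = - y i by rewrite crossC.
have myc i : m (y i) c = - x i by rewrite /y crossK // cc xc scale0r addr0 scaleN1r.
have myx i : m (y i) (x i) = c.
  rewrite /y [m (x i) c]crossC // linearNl /= crossK // xx eqxx cx scale0r addr0.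
  by rewrite scaleN1r opprK.
have myxn i j : i != j -> m (y i) (x j) = - m (m (x i) (x j)) c.
  by move=> ij; apply: cross_swap => //; rewrite xx (negPf ij).
have myx1 i : m (y i) (x (i + 1)) = - y (i + 1 + 1) by rewrite myxn ?I3_neq // mxx.
have mxx2 i : m (x i) (x (i + 1 + 1)) = - x (i + 1).
  by rewrite crossC // -{2}(I3_add3 i) mxx I3_add3.
have myx2 i : m (y i) (x (i + 1 + 1)) = y (i + 1).
  by rewrite myxn ?I3_neq // mxx2 linearNl opprK.
have cy i : b c (y i) = 0 by apply: dotp_crossr.
have xy i j : b (x i) (y j) = 0.
  rewrite -dotp_cross //; have [->|->|->] := I3_cases i j.
  - by rewrite crossxx // linear0l.
  - by rewrite mxx xc.
  - by rewrite mxx2 linearNl /= xc oppr0.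
have yy i j : b (y i) (y j) = (i == j)%:R.
  by rewrite dotp_cross // [m c _]crossC // myc opprK xx.
have myyn i j : m (y i) (y j) = - m (m (x i) (y j)) c.
  by apply: cross_swap.
have myy1 i : m (y i) (y (i + 1)) = - x (i + 1 + 1).
  rewrite myyn [m (x i) _]crossC // -{2}(I3_add3 i) myx2 linearNl opprK.
  by rewrite /= myc.
have myy2 i : m (y i) (y (i + 1 + 1)) = x (i + 1).
  by rewrite crossC // -{2}(I3_add3 i) myy1 I3_add3 opprK.
split=> [[[i u]|] [[j v]|]|[[i u]|] [[j v]|]] /=.
- case: u v => [] [] /=.
  + have [->|->|->] := I3_cases i j;
      rewrite ?eqxx ?I3_neq /cyc_sign ?I3_neq ?eqxx ?I3_third /=.
    * by rewrite crossxx // scale0r.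
    * by rewrite scaleN1r.
    * by rewrite myy2 opprK scale1r.
  + have [->|->|->] := I3_cases i j;
      rewrite ?eqxx ?I3_neq /cyc_sign ?I3_neq ?eqxx ?I3_third /=.
    * by rewrite scale1r.
    * by rewrite scaleN1r.
    * by rewrite opprK scale1r.
  + rewrite crossC //.
    have [->|->|->] := I3_cases i j;
      rewrite ?eqxx ?I3_neq /cyc_sign ?I3_neq ?eqxx ?I3_third /=.
    * by rewrite myx scaleN1r.
    * by rewrite -{2}(I3_add3 i) myx2 scaleN1r.
    * by rewrite -{2}(I3_add3 i) myx1 I3_add3 !opprK scale1r.
  + have [->|->|->] := I3_cases i j;
      rewrite ?eqxx ?I3_neq /cyc_sign ?I3_neq ?eqxx ?I3_third /=.
    * by rewrite crossxx // scale0r.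
    * by rewrite mxx scale1r.
    * by rewrite mxx2 scaleN1r.
- by case: u; rewrite ?myc ?scaleN1r ?scale1r.
- by rewrite crossC //; case: v; rewrite ?myc ?opprK ?scale1r ?scaleN1r.
- by rewrite crossxx // scale0r.
- rewrite (inj_eq (@Some_inj _)) xpair_eqE [j == i]eq_sym.
  case: u v => [] []; rewrite ?xx ?yy ?xy ?[b (y i) _]dotpC ?xy ?andbF // andbT.
  1,2: by rewrite 1?[j == i]eq_sym; case: eqP.
- by rewrite dotpC; case: u.
- by case: v.
- exact: cc.
Qed.

End Constructions.

(** * Homogeneous elements of gradings *)

Section GradingTheory.
Context {F : fieldType} {A : invAlg F} {G : zmodType} (Gam : grading A G).

Definition gproj (g : G) : 'End(A) :=
  if (insub g : option (usupp Gam)) is Some u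
  then sumv_pi (\sum_(u : usupp Gam) Gam (val u))%VS u else 0.

Lemma gproj_mem g x : gproj g x \in Gam g.
Proof.
rewrite /gproj; case: insubP => [u _ <-|_]; first exact: memv_sum_pi.
by rewrite zero_lfunE mem0v.
Qed.

Lemma gproj_sum x : x = \sum_(u : usupp Gam) gproj (val u) x.
Proof.
transitivity (\sum_(u : usupp Gam)
    sumv_pi (\sum_(u : usupp Gam) Gam (val u))%VS u x).
  by rewrite (sumv_pi_sum (erefl _)) // gcomp_full memvf.
by apply: eq_bigr => u _; rewrite /gproj valK.
Qed.

Lemma gsupp_neq0 g x : x \in Gam g -> x != 0 -> g \in gsupp Gam.
Proof.
move=> xg; apply: contraNT; rewrite mem_gsupp negbK => /eqP g0.
by rewrite g0 memv0 in xg.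
Qed.

Lemma gproj_hom g h x : x \in Gam h -> gproj g x = if g == h then x else 0.
Proof.
move=> xh; have [->|x0] := eqVneq x 0; first by rewrite linear0 if_same.
have hs := gsupp_neq0 xh x0; pose u0 : usupp Gam := SeqSub hs.
have e (u : usupp Gam) : gproj (val u) x = if val u == h then x else 0.
  (* Two decompositions of [x]: its projections, and [x] itself in degree [h] with 0 elsewhere.
     Directness identifies them. *)
  pose us (u : usupp Gam) := gproj (val u) x.
  pose vs (u : usupp Gam) := if val u == h then x else 0.
  have us_mem u' : true -> us u' \in Gam (val u') by move=> _; apply: gproj_mem.
  have vs_mem u' : true -> vs u' \in Gam (val u').
    by rewrite /vs; case: eqP => [->|]; rewrite ?mem0v.
  have /directv_sum_unique/(_ us vs us_mem vs_mem) := gcomp_direct Gam.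
  rewrite -[X in X == _](gproj_sum x) (bigD1 u0) //= {1}/vs eqxx big1 ?addr0 => [|v].
    by rewrite eqxx => /esym/forallP/(_ u)/eqP.
  by rewrite -val_eqE /= /vs => /negPf ->.
case gs: (g \in gsupp Gam); first by rewrite -(e (SeqSub gs)).
rewrite /gproj insubF // zero_lfunE; case: eqP => // gh.
by rewrite gh hs in gs.
Qed.

Lemma degree_unique g h x : x \in Gam g -> x \in Gam h -> x != 0 -> g = h.
Proof.
move=> xg xh; have := gproj_hom g xh; rewrite (gproj_hom g xg) eqxx.
by case: eqP => // _ ->; rewrite eqxx.
Qed.

End GradingTheory.

(** * Products of T(C) in terms of [cross] and [dotp] *)

Section SmirnovProducts.
Context {F : fieldType} {C : cayleyAlg F}.
Hypothesis nz2 : (2%:R : F) != 0.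
Local Notation S := (cskew C).
Local Notation H := (symsq S).
Local Notation T := (smirnov C).

Implicit Types s t u v : S.

Definition inS (s : S) : T := (0, s).
Definition inH (h : H) : T := (h, 0).

Fact inS_is_linear : linear inS.
Proof. by move=> a x y; congr pair; rewrite /= scaler0 addr0. Qed.
HB.instance Definition _ := GRing.isLinear.Build F S T _ inS inS_is_linear.

Fact inH_is_linear : linear inH.
Proof. by move=> a x y; congr pair; rewrite /= scaler0 addr0. Qed.
HB.instance Definition _ := GRing.isLinear.Build F H T _ inH inH_is_linear.

Lemma smirnov_split (x : T) : x = inH x.1 + inS x.2.
Proof. by case: x => h s; congr pair; rewrite /= ?addr0 ?add0r. Qed.

Lemma mulSS s t : ia_mul T (inS s) (inS t) = inH (sprod s t) + inS (cross s t).
Proof.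
rewrite -[LHS]/(smirnov_mul _ _) /smirnov_mul smirnov_dotSS smirnov_brkSS.
by congr pair; rewrite /= ?crossE ?scaler0.
Qed.

Lemma mulSH s t u : ia_mul T (inS s) (inH (sprod t u)) =
  inH (sprod (cross s t) u + sprod t (cross s u)) + inS (dotSH s t u).
Proof.
rewrite -[LHS]/(smirnov_mul _ _) /smirnov_mul smirnov_dotSH smirnov_brkSH.
congr pair; rewrite /= ?scaler0 ?addr0 ?add0r //.
by rewrite !crossE linearZl_LR linearZr_LR scalerDr.
Qed.

Lemma mulHS s t u : ia_mul T (inH (sprod t u)) (inS s) =
  - inH (sprod (cross s t) u + sprod t (cross s u)) + inS (dotSH s t u).
Proof.
rewrite -[LHS]/(smirnov_mul _ _) /smirnov_mul smirnov_dotC smirnov_brkC.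
rewrite smirnov_dotSH smirnov_brkSH.
congr pair; rewrite /= ?oppr0 ?scaler0 ?addr0 ?add0r //.
by rewrite !crossE linearZl_LR linearZr_LR scalerN scalerDr.
Qed.

Lemma brkHHE s t u v : 2%:R^-1 *: brkHH s t u v =
  - (dotp s u *: cross t v + dotp s v *: cross t u
     + dotp t u *: cross s v + dotp t v *: cross s u).
Proof.
have e (p q x y : S) : dotp p q *: cross x y =
    (2%:R^-1 * 2%:R^-1 * sform p q) *: scomm x y.
  by rewrite dotpE crossE scalerA mulrC mulrA.
by rewrite /brkHH scalerN !e scalerA !scalerDr !scalerA.
Qed.

Lemma dotHHE s t u v : dotHH s t u v =
  sprod (cross s u) (cross t v) + sprod (cross s v) (cross t u)
  - (2%:R * dotp s t) *: sprod u v - (2%:R * dotp u v) *: sprod s t.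
Proof.
have e (x y z w : S) : sprod (cross x y) (cross z w) =
    4%:R^-1 *: sprod (scomm x y) (scomm z w).
  by rewrite !crossE linearZl_LR linearZr_LR /= scalerA -invfM -natrM.
by rewrite /dotHH -!(sformE nz2) !e scalerDr.
Qed.

Lemma mulHH s t u v : ia_mul T (inH (sprod s t)) (inH (sprod u v)) =
  inH (dotHH s t u v) + inS (2%:R^-1 *: brkHH s t u v).
Proof.
rewrite -[LHS]/(smirnov_mul _ _) /smirnov_mul smirnov_dotHH smirnov_brkHH.
by congr pair; rewrite /= ?scaler0 ?addr0.
Qed.

Lemma dotSHE s t u :
  dotSH s t u = - (2%:R * dotp t u) *: s - (dotp s t *: u + dotp s u *: t).
Proof.
rewrite /dotSH !(sformE nz2) scaleNr scalerDr !scalerA.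
by rewrite !(mulKf nz2).
Qed.

End SmirnovProducts.

Section Homogeneous.
Context {F : fieldType} {C : cayleyAlg F}.
Hypothesis nz2 : (2%:R : F) != 0.
Local Notation S := (cskew C).
Local Notation m := (@cross F C).
Local Notation b := (@dotp F C).
Context {G : zmodType} (Gam : grading (smirnov C) G).

Definition homog (g : G) (s : S) : Prop := inS s \in Gam g.

(** The involution preserves each component, and the S-part of [x] is half the difference of [x] and
    its image. *)
Lemma gcomp_split g x : (x \in Gam g) = (inH x.1 \in Gam g) && (inS x.2 \in Gam g).
Proof.
apply/idP/andP => [xg|[h s]]; last by rewrite [x]smirnov_split memvD.
have xg' := gcomp_inv xg.
have eS : inS x.2 = 2%:R^-1 *: (x - ia_inv (smirnov C) x).
  apply: (scalerI nz2); rewrite scalerA divff // scale1r scaler_nat mulr2n.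
  by case: (x) => h s; congr pair; rewrite /= ?subrr ?addr0 ?opprK.
have sg : inS x.2 \in Gam g by rewrite eS memvZ // memvB.
by split=> //; rewrite -[inH _](addrK (inS x.2)) -smirnov_split memvB.
Qed.

Lemma gcomp_pair g h s :
  (inH h + inS s \in Gam g) = (inH h \in Gam g) && (inS s \in Gam g).
Proof.
rewrite [LHS]gcomp_split -[(_ + _).1]/(h + 0) -[(_ + _).2]/(0 + s).
by rewrite addr0 add0r.
Qed.

Lemma hom0 g : homog g 0. Proof. by rewrite /homog linear0 mem0v. Qed.

Lemma homD g s t : homog g s -> homog g t -> homog g (s + t).
Proof. by rewrite /homog linearD; apply: memvD. Qed.

Lemma homZ g k s : homog g s -> homog g (k *: s).
Proof. by rewrite /homog linearZ; apply: memvZ. Qed.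

Lemma hom_uniq g h s : homog g s -> homog h s -> s != 0 -> g = h.
Proof.
move=> sg sh s0; apply: degree_unique sg sh _.
by apply: contra_neq s0 => -[].
Qed.

Lemma hom_mul g h s t : homog g s -> homog h t ->
  inH (sprod s t) \in Gam (g + h) /\ homog (g + h) (m s t).
Proof.
move=> sg th; have := gcompM sg th; rewrite mulSS gcomp_pair.
by move/andP.
Qed.

Lemma hom_cross g h s t : homog g s -> homog h t -> homog (g + h) (m s t).
Proof. by move=> sg th; have [] := hom_mul sg th. Qed.

Lemma hom_sprod g h s t : homog g s -> homog h t -> inH (sprod s t) \in Gam (g + h).
Proof. by move=> sg th; have [] := hom_mul sg th. Qed.

Definition sproj (g : G) (s : S) : S := (gproj Gam g (inS s)).2.

Fact sproj_is_linear g : linear (sproj g).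
Proof. by move=> a x y; rewrite /sproj !linearP. Qed.
HB.instance Definition _ g :=
  GRing.isLinear.Build F S S _ (sproj g) (sproj_is_linear g).

Lemma sproj_hom g s : homog g (sproj g s).
Proof. by have := gproj_mem Gam g (inS s); rewrite gcomp_split => /andP[]. Qed.

Lemma sproj_sum s : s = \sum_(u : usupp Gam) sproj (val u) s.
Proof.
have /(congr1 snd) := gproj_sum Gam (inS s).
by rewrite (raddf_sum (@snd (symsq S) S)).
Qed.

Lemma sproj_id g h s : homog h s -> sproj g s = if g == h then s else 0.
Proof. by move=> sh; rewrite /sproj (gproj_hom g sh); case: eqP. Qed.

(** Homogeneous vectors span S; this supplies every homogeneous vector in general position used
    below. *)
Lemma hom_outside (W : {vspace S}) : W != fullv -> exists g s, homog g s /\ s \notin W.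
Proof.
rewrite eqEsubv subvf /= => /subvPn[s _ sW].
have /forallPn[u uW] : ~~ [forall u : usupp Gam, sproj (val u) s \in W].
  by apply: contra sW => /forallP sW; rewrite (sproj_sum s) memv_suml.
by exists (val u), (sproj (val u) s); split=> //; apply: sproj_hom.
Qed.

Lemma small_span (X : seq S) : (size X < 7)%N -> <<X>>%VS != fullv.
Proof.
move=> X7; apply/eqP => Xf; have := dim_span X.
by rewrite Xf dim_cskew // leqNgt X7.
Qed.

(* If g + h <> 0, the operator v |-> v . (s x t) = - n(s, t) v - ... is homogeneous
   of nonzero degree, so that every homogeneous v lies in the span of s and t. *)
Lemma hom_dotp g h s t : homog g s -> homog h t -> b s t != 0 -> g + h = 0.
Proof.
move=> sg th st; apply/eqP; apply: contraTT isT => d0.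
have [|a [v [va]]] := hom_outside (small_span (X := [:: s; t]) _) => //.
case/negP; have c0 : - (2%:R * b s t) != 0 by rewrite oppr_eq0 mulf_neq0.
have dh : homog (a + (g + h)) (dotSH v s t).
  have := gcompM va (hom_sprod sg th); by rewrite mulSH gcomp_pair => /andP[].
(* In degree [a] the left-hand side vanishes, and the projections of [s] and [t] are these vectors
   or 0, so the equation can be solved for [v] in their span. *)
have /(congr1 (sproj a)) := dotSHE nz2 v s t.
rewrite (sproj_id a dh) -{1}[a]addr0 (inj_eq (addrI a)) eq_sym (negPf d0).
rewrite linearB linearD !linearZ /= (sproj_id a va) eqxx => /esym/eqP.
have in_span x y : homog x y -> y \in [:: s; t] -> sproj a y \in <<[:: s; t]>>%VS.
  by move=> xy yX; rewrite (sproj_id a xy); case: eqP => _; rewrite ?mem0v ?memv_span.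
rewrite subr_eq0 => /eqP/(congr1 ( *:%R (- (2%:R * b s t))^-1)).
rewrite scalerA mulVf // scale1r => ->; rewrite memvZ // memvD // memvZ //.
  by apply: in_span th _; rewrite !inE eqxx orbT.
by apply: in_span sg _; rewrite !inE eqxx.
Qed.

Lemma hom_pairing g s : homog g s -> s != 0 -> exists t, homog (- g) t /\ b s t != 0.
Proof.
move=> sg s0; have [t st] : exists t, b s t != 0.
  apply: contrapT => /forallNP nt; case/eqP: s0; apply: (dotp_nondeg nz2) => y.
  by apply/eqP; apply: contraT => /nt.
have /forallPn[u ut] : ~~ [forall u : usupp Gam, b s (sproj (val u) t) == 0].
  apply: contra st => /forallP s_t.
  by rewrite (sproj_sum t) linear_sumr big1 // => u _; apply/eqP/s_t.
exists (sproj (val u) t); split=> //; have tu := sproj_hom (val u) t.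
have /eqP := hom_dotp sg tu ut; rewrite addrC addr_eq0 => /eqP ug.
by rewrite -ug.
Qed.

End Homogeneous.

(** * Homogeneous frames *)

Section Eigenprojections.
Context {F : fieldType} {C : cayleyAlg F}.
Hypothesis nz2 : (2%:R : F) != 0.
Local Notation S := (cskew C).
Local Notation m := (@cross F C).
Local Notation b := (@dotp F C).
Variable w : S.
Hypothesis ww : b w w = -1.

(** For [k] = 1 or -1, twice the projection onto the [k]-eigenspace of [cross w]: since b(w, w) =
    -1, the first two terms give the part of [s] orthogonal to [w], where [cross w] squares to the
    identity. *)
Definition wproj (k : F) (s : S) : S := s + b w s *: w + k *: m w s.

Fact wproj_is_linear k : linear (wproj k).
Proof.
apply: lin_add; last by apply: lin_scale => a x y; rewrite linearPr.
by apply: lin_add => //; apply: lin_scal => a x y; rewrite linearPr.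
Qed.
HB.instance Definition _ k :=
  GRing.isLinear.Build F S S _ (wproj k) (wproj_is_linear k).

Lemma cross_wproj k s : k * k = 1 -> m w (wproj k s) = k *: wproj k s.
Proof.
move=> kk; have -> : m w (wproj k s) = m w s + k *: (s + b w s *: w).
  rewrite /wproj !linearDr !linearZr_LR /= crossxx // scaler0 addr0.
  by rewrite [m w (m w s)]crossC // [m w s]crossC // linearNl /= crossK // ww !opprK
    scale1r [b s w]dotpC.
by rewrite /wproj [RHS]scalerDr scalerA kk scale1r addrC.
Qed.

(** Through this formula nondegeneracy of [dotp] puts the two eigenspaces in duality. *)
Lemma dotp_wproj k s y : k * k = 1 -> m w y = - k *: y ->
  b (wproj k s) y = 2%:R * b s y.
Proof.
move=> kk wy; have k0 : - k != 0.
  by rewrite oppr_eq0; apply: contra_eq_neq kk => ->; rewrite mul0r eq_sym oner_eq0.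
rewrite /wproj !linearDl !linearZl_LR /= (eigen_dotw nz2 k0 wy) mulr0 addr0.
rewrite crossC // linearNl /= dotp_cross // wy linearZr_LR /= mulNr opprK.
by rewrite mulrA kk; ring.
Qed.

Lemma wproj_split s : s = - b w s *: w + 2%:R^-1 *: (wproj 1 s + wproj (-1) s).
Proof.
have -> : wproj 1 s + wproj (-1) s = 2%:R *: (s + b w s *: w).
  rewrite /wproj addrACA scale1r scaleN1r subrr addr0.
  by rewrite scaler_nat mulr2n.
by rewrite scalerA mulVf // scale1r addrCA scaleNr addNr addr0.
Qed.

(* If the trilinear form vanished on the 1-eigenspace of w x _, the cross product
   would vanish there too, and both eigenspaces would be lines. *)
Lemma trilinear_neq0 (P : S -> Prop) :
  (forall W : {vspace S}, W != fullv -> exists s, P s /\ s \notin W) ->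
  exists x y z, [/\ P x, P y, P z &
    b (m (wproj 1 x) (wproj 1 y)) (wproj 1 z) != 0].
Proof.
move=> outP.
have lin0 (f : S -> F) : scalar f -> (forall s, P s -> f s = 0) -> forall s, f s = 0.
  move=> fl f0 s.
  pose fL : {linear S -> F^o} := HB.pack f (GRing.isLinear.Build F S F^o _ f fl).
  have : lker (linfun fL) == fullv.
    apply: contraT => /outP[t [/f0 ft]]; rewrite memv_ker lfunE /= ft eqxx //.
  by move=> /eqP kf; have := memvf s; rewrite -kf memv_ker lfunE => /eqP.
apply: contrapT => none.
have t0 x y z : P x -> P y -> P z -> b (m (wproj 1 x) (wproj 1 y)) (wproj 1 z) = 0.
  by move=> px py pz; apply/eqP; apply: contraT => nz; case: none; exists x, y, z.
(* [P] spans S, so the vanishing extends from [P] to S in one argument at a time. *)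
have {}t0 x y z : b (m (wproj 1 x) (wproj 1 y)) (wproj 1 z) = 0.
  move: x; apply: (lin0 _) => [a u v|x px].
    by rewrite linearP linearPl /= linearPl.
  move: y; apply: (lin0 _) => [a u v|y py].
    by rewrite linearP linearPr /= linearPl.
  move: z; apply: (lin0 _) => [a u v|z pz]; first by rewrite linearP linearPr.
  exact: t0.
have k1 : 1 * 1 = 1 :> F by rewrite mulr1.
have kN : -1 * -1 = 1 :> F by rewrite mulrNN mulr1.
have wp s : m w (wproj 1 s) = 1 *: wproj 1 s by apply: cross_wproj.
have wn s : m w (wproj (-1) s) = -1 *: wproj (-1) s by apply: cross_wproj.
have neg0 v : m w v = -1 *: v -> (forall z, b v (wproj 1 z) = 0) -> v = 0.
  move=> wv v0; apply: (dotp_nondeg nz2) => z; apply: (mulfI nz2).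
  by rewrite mulr0 [b v z]dotpC -(dotp_wproj z k1 wv) dotpC.
have mpp x y : m (wproj 1 x) (wproj 1 y) = 0.
  by apply: neg0 => // ; apply: (eigen_cross nz2 (oner_neq0 F)).
have [x [z xz]] : exists x z, b (wproj 1 x) (wproj (-1) z) != 0.
  apply: contrapT => /forallNP no.
  have xz x z : b (wproj 1 x) (wproj (-1) z) = 0.
    by apply/eqP; apply: contraT => nz; case: (no x); exists z.
  have n0 z : wproj (-1) z = 0 by apply: neg0 => // x; rewrite dotpC.
  have p0 x : wproj 1 x = 0.
    apply: (dotp_nondeg nz2) => z; apply: (mulfI nz2); rewrite mulr0 [b _ z]dotpC.
    by rewrite -(dotp_wproj (k := -1)) ?n0 ?linear0l // opprK.
  have [s [_]] := outP _ (small_span nz2 (X := [:: w]) isT).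
  rewrite [s]wproj_split n0 p0 addr0 scaler0 addr0 memvZ //.
  by rewrite memv_span1.
set u := wproj 1 x in xz; set v := wproj (-1) z in xz.
(* In [crossA] the first product is 0 by [mpp], and u x v is a multiple of [w]; what remains makes
   the 1-eigenspace the line of [u]. *)
have prop y : b u v *: wproj 1 y = b (wproj 1 y) v *: u.
  have := crossA nz2 u (wproj 1 y) v; rewrite mpp linear0l add0r.
  have wu1 : m w u = u by rewrite wp scale1r.
  have wv1 : m w v = - v by rewrite wn scaleN1r.
  rewrite (eigen_cross_opp nz2 wu1 wv1) linearZl_LR /= wp scale1r.
  rewrite (eigen_dot0 nz2 (oner_neq0 F) (wp x) (wp y)) scale0r addr0.
  move/eqP; rewrite !scaleNr eq_sym addrC subr_eq [- _ + _]addrC eq_sym subr_eq.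
  by rewrite -mulr2n -scaler_nat -scalerA => /eqP/(scalerI nz2) ->.
have [s [_ /negP]] := outP _ (small_span nz2 (X := [:: w; u; v]) isT).
have inX t : t \in [:: w; u; v] -> t \in <<[:: w; u; v]>>%VS by apply: memv_span.
case; rewrite [s]wproj_split; apply: memvD; first by rewrite memvZ // inX ?inE ?eqxx.
apply/memvZ/memvD.
  have -> : wproj 1 s = (b u v)^-1 *: (b (wproj 1 s) v *: u).
    by rewrite -prop scalerA mulVf // scale1r.
  by rewrite !memvZ // inX ?inE ?eqxx ?orbT.
(* By duality the other eigenspace is the line of [v]: this combination is orthogonal to every
   [wproj 1 y]. *)
have : b u v *: wproj (-1) s - b u (wproj (-1) s) *: v = 0.
  apply: neg0 => [|y].
    rewrite linearBr !linearZr_LR /= wn [m w v]wn !scaleN1r !scalerN.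
    by rewrite opprB opprK addrC.
  rewrite linearBl !linearZl_LR /= -/v; apply/eqP; rewrite subr_eq0; apply/eqP.
  rewrite [b _ (wproj 1 y)]dotpC [b v _]dotpC -(linearZl_LR (@dotp F C)) /=.
  by rewrite prop linearZl_LR /= mulrC.
move/eqP; rewrite subr_eq0 => /eqP e.
have -> : wproj (-1) s = (b u v)^-1 *: (b u (wproj (-1) s) *: v).
  by rewrite -e scalerA mulVf // scale1r.
by rewrite !memvZ // inX ?inE ?eqxx ?orbT.
Qed.

End Eigenprojections.

Section FrameExistence.
Context {F : closedFieldType} {C : cayleyAlg F}.
Hypothesis nz2 : (2%:R : F) != 0.
Local Notation S := (cskew C).
Local Notation m := (@cross F C).
Local Notation b := (@dotp F C).

Let nzN1 : (-1 : F) != 0. Proof. by rewrite oppr_eq0 oner_eq0. Qed.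

(** [P] is abstract to serve twice: always true for the bare existence of a frame, homogeneity for a
    given grading. The first conjunct then carries homogeneity over to the x_i. *)
Lemma cartan_vectors (w : S) (P : S -> Prop) : b w w = -1 ->
  (forall W : {vspace S}, W != fullv -> exists s, P s /\ s \notin W) ->
  exists x : 'I_3 -> S,
    (forall i, exists c s, P s /\ x i = c *: wproj w 1 s) /\
    is_frame (cartan_table F)
      (mk_frame w x (fun i => m (x (i + 1)) (x (i + 1 + 1)))).
Proof.
move=> ww outP; have [x [y [z [px py pz xyz]]]] := trilinear_neq0 nz2 ww outP.
pose q := fun i : 'I_3 => if i == 0 then
    (b (m (wproj w 1 x) (wproj w 1 y)) (wproj w 1 z))^-1 *: wproj w 1 x
  else if i == 0 + 1 then wproj w 1 y else wproj w 1 z.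
have wp c : m w (wproj w 1 c) = wproj w 1 c.
  by rewrite cross_wproj ?mulr1 // scale1r.
exists q; split=> [i|].
  rewrite /q; case: ifP => _; first by eexists; exists x.
  by case: ifP => _; exists 1; [exists y|exists z]; rewrite scale1r.
apply: cartan_frame => // [i|].
  by rewrite /q; case: ifP => _; [rewrite linearZr_LR /= wp|case: ifP].
by rewrite linearZl_LR linearZl_LR /= mulVf.
Qed.

Lemma exists_cartan_frame : exists e : idx -> S, is_frame (cartan_table F) e.
Proof.
have outT (W : {vspace S}) : W != fullv -> exists s, True /\ s \notin W.
  by rewrite eqEsubv subvf => /subvPn[s _ sW]; exists s.
have [s [_ s0]] := outT _ (small_span nz2 (X := [::]) isT).
have {}s0 : s != 0 by apply: contraNneq s0 => ->; rewrite mem0v.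
have [t st] : exists t, b s t != 0.
  apply: contrapT => /forallNP nt; case/eqP: s0; apply: (dotp_nondeg nz2) => y.
  by apply/eqP; apply: contraT => /nt.
have [v vv] : exists v, b v v != 0.
  by have /or3P[] := anisotropic_exists nz2 st; [exists s|exists t|exists (s + t)].
have [k _ ww] := dotp_scale vv nzN1.
by have [x [_ fx]] := cartan_vectors ww outT; eexists; apply: fx.
Qed.

(* From a Cartan frame: (-1)^(1/2) w, x_0 + y_0 / 2 and x_1 + y_1 / 2. *)
Lemma exists_octonion_frame : exists e : idx -> S, is_frame (octonion_table F) e.
Proof.
have [e [em eb]] := exists_cartan_frame; have [r r2] := sqrt_exists (-1 : F).
pose x := e (Some (0, false)); pose y := e (Some (0, true)).
pose x1 := e (Some (0 + 1, false)); pose y1 := e (Some (0 + 1, true)).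
pose k : F := 2%:R^-1.
have bE i j : b (e i) (e j) = if j == cartan_dual i then cartan_form F i else 0 by [].
have mwx : m (e None) x = x by rewrite em /= scale1r.
have mwy : m (e None) y = - y by rewrite em /= scaleN1r.
(* The norm is 2 k b(u, v), whence [k] = 1/2; likewise [r] compensates b(w, w) = -1. *)
have norm u v : b u u = 0 -> b v v = 0 -> b u v = 1 -> b (u + k *: v) (u + k *: v) = 1.
  move=> uu vv uv; rewrite linearDl !linearDr !linearZl_LR !linearZr_LR /=.
  by rewrite uu vv [b v u]dotpC uv !mulr0 mulr1 add0r addr0 half2.
eexists; apply: (@octonion_frame F C nz2 (r *: e None) (x + k *: y) (x1 + k *: y1)).
- by rewrite linearZl_LR linearZr_LR /= bE mulrA -expr2 r2 mulrNN mulr1.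
- by apply: norm; rewrite bE.
- by apply: norm; rewrite bE.
- by rewrite linearZl_LR linearDr linearZr_LR /= !bE /= !(mulr0, addr0).
- by rewrite linearZl_LR linearDr linearZr_LR /= !bE /= !(mulr0, addr0).
- rewrite linearDl !linearDr !linearZl_LR !linearZr_LR /= !bE /=.
  by rewrite !(mulr0, addr0).
- have -> : m (r *: e None) (x + k *: y) = r *: (x - k *: y).
    by rewrite linearZl_LR linearDr linearZr_LR /= mwx mwy scalerN.
  rewrite linearZl_LR linearBl !linearDr !linearZl_LR !linearZr_LR /= !bE /=.
  by rewrite !(mulr0, addr0, oppr0).
Qed.

End FrameExistence.

Section HomogeneousFrames.
Context {F : closedFieldType} {C : cayleyAlg F}.
Hypothesis nz2 : (2%:R : F) != 0.
Local Notation S := (cskew C).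
Local Notation m := (@cross F C).
Local Notation b := (@dotp F C).
Context {G : zmodType} (Gam : grading (smirnov C) G).

Let nzN1 : (-1 : F) != 0. Proof. by rewrite oppr_eq0 oner_eq0. Qed.

Lemma hom_cartan s : homog Gam 0 s -> s != 0 ->
  exists (e : idx -> S) (u : idx -> G),
    is_frame (cartan_table F) e /\ forall i, homog Gam (u i) (e i).
Proof.
(* Degree 0 is its own opposite, so the form pairs S_0 with itself and some vector of S_0 is
   anisotropic. *)
move=> s_hom s0; have [t [t_hom st]] := hom_pairing nz2 s_hom s0.
rewrite oppr0 in t_hom.
have [v [v_hom vv]] : exists v, homog Gam 0 v /\ b v v != 0.
  have /or3P[ss|tt|stt] := anisotropic_exists nz2 st.
  - by exists s.
  - by exists t.
  - by exists (s + t); split=> //; apply: homD.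
have [k _ ww] := dotp_scale vv nzN1; set w := k *: v in ww.
have w_hom : homog Gam 0 w by apply: homZ.
(* The term b(w, x) w is the only delicate one: its coefficient is nonzero only for [x] of degree
   0. *)
have p_hom g x : homog Gam g x -> homog Gam g (wproj w 1 x).
  move=> xg; apply: homD; last by rewrite scale1r -[g]add0r; apply: hom_cross.
  apply: homD => //; have [->|wx] := eqVneq (b w x) 0.
    by rewrite scale0r; apply: hom0.
  have := hom_dotp nz2 w_hom xg wx; rewrite add0r => ->; exact: homZ.
have [|x [xE fx]] := @cartan_vectors F C nz2 w (fun x => exists g, homog Gam g x) ww.
  move=> W /(hom_outside nz2 Gam)[g [x [xg xW]]].
  by exists x; split=> //; exists g.
have x_hom i : exists g, homog Gam g (x i).
  by have [c [s' [[g gs] ->]]] := xE i; exists g; apply/homZ/p_hom.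
have /choice[u uP] : forall p, exists g,
    homog Gam g (mk_frame w x (fun i => m (x (i + 1)) (x (i + 1 + 1))) p).
  case=> [[i []]|] /=; [|exact: x_hom|by exists 0].
  have [[g1 h1] [g2 h2]] := (x_hom (i + 1), x_hom (i + 1 + 1)).
  by exists (g1 + g2); apply: hom_cross.
by eexists; exists u; split; first exact: fx.
Qed.

Lemma hom_octonion : (forall s, homog Gam 0 s -> s = 0) ->
  exists (e : idx -> S) (u : idx -> G),
    is_frame (octonion_table F) e /\ forall i, homog Gam (u i) (e i).
Proof.
move=> no0.
have aniso g x : homog Gam g x -> x != 0 -> g + g = 0 /\ b x x != 0.
  move=> xg x0; have [y [yg xy]] := hom_pairing nz2 xg x0.
  have mxy : m x y = 0 by apply: no0; rewrite -(subrr g); apply: hom_cross.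
  have := crossK nz2 x y; rewrite mxy linear0l => /esym/eqP.
  rewrite addrC scaleNr subr_eq0 => /eqP e.
  have yE : y = ((b x y)^-1 * b y y) *: x.
    by rewrite -scalerA -e scalerA mulVf // scale1r.
  split; last by apply: contraNneq xy => xx; rewrite yE linearZr_LR /= xx mulr0.
  have y0 : y != 0 by apply: contraNneq xy => ->; rewrite linear0r.
  have yg' : homog Gam g y by rewrite yE; apply: homZ.
  by rewrite {1}(hom_uniq yg' yg y0) addNr.
have line g x y : homog Gam g x -> homog Gam g y -> x != 0 -> y \in <[x]>%VS.
  move=> xg yg x0; have [gg xx] := aniso g x xg x0.
  have myx : m y x = 0 by apply: no0; rewrite -gg; apply: hom_cross.
  have := crossK nz2 y x; rewrite myx linear0l => /esym/eqP.
  rewrite addrC scaleNr subr_eq0 => /eqP e; apply/vlineP.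
  by exists ((b x x)^-1 * b y x); rewrite -scalerA e scalerA mulVf // scale1r.
have unit g x : homog Gam g x -> x != 0 ->
    exists x', [/\ homog Gam g x', b x' x' = 1, x' != 0 & x \in <[x']>%VS].
  move=> xg x0; have [_ xx] := aniso g x xg x0.
  have [k k0 kx] := dotp_scale xx (oner_neq0 F).
  exists (k *: x); split=> //; first exact: homZ.
    by rewrite scaler_eq0 negb_or k0.
  by apply/vlineP; exists k^-1; rewrite scalerA mulVf // scale1r.
have pick X : (size X < 7)%N -> exists g x,
    [/\ homog Gam g x, b x x = 1, x != 0 & x \notin <<X>>%VS].
  move=> /(small_span nz2)/(hom_outside nz2 Gam)[g [x [xg xX]]].
  have x0 : x != 0 by apply: contraNneq xX => ->; rewrite mem0v.
  have [x' [xg' xx x0' xx']] := unit g x xg x0; exists g, x'; split=> //.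
  by apply: contra xX => x'X; case/vlineP: xx' => k ->; rewrite memvZ.
(* If b(x, y) were nonzero, [y] would have degree -g = g and lie on the line of [x]. *)
have ortho g h x y X : homog Gam g x -> homog Gam h y -> x != 0 -> y \notin <<X>>%VS ->
    x \in X -> b x y = 0.
  move=> xg yh x0 yX xX; apply/eqP; apply: contraT => xy.
  have gh := hom_dotp nz2 xg yh xy; have [gg _] := aniso g x xg x0.
  case/negP: yX; have hg : h = g by apply: (addrI g); rewrite gh gg.
  rewrite hg in yh; have /vlineP[k ->] := line g x y xg yh x0.
  by rewrite memvZ // memv_span.
have [gp [p [p_hom pp p0 _]]] := pick [::] isT.
have [gq [q [q_hom qq q0 qX]]] := pick [:: p] isT.
have pq : b p q = 0 by apply: ortho p_hom q_hom p0 qX _; rewrite inE.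
have pq_hom := hom_cross nz2 p_hom q_hom.
have pq0 : m p q != 0.
  apply: contraNneq p0 => e; have := crossK nz2 p q.
  by rewrite e linear0l qq pq scale0r addr0 scaleN1r => /esym/eqP; rewrite oppr_eq0.
have [gc [c [c_hom cc c0 cX]]] := pick [:: p; q; m p q] isT.
pose x := fun i : 'I_3 => if i == 0 then p else if i == 0 + 1 then q else m p q.
have x_hom i : exists g, homog Gam g (x i).
  by rewrite /x; case: ifP => _; [|case: ifP => _]; eexists; eassumption.
have /choice[u uP] : forall i, exists g,
    homog Gam g (mk_frame c x (fun i => m (x i) c) i).
  case=> [[i []]|] /=; [|exact: x_hom|by exists gc].
  by have [g1 h1] := x_hom i; exists (g1 + gc); apply: hom_cross.
eexists; exists u; split; last exact: uP.
apply: octonion_frame => //; [apply: ortho p_hom c_hom p0 cX _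
  |apply: ortho q_hom c_hom q0 cX _|apply: ortho pq_hom c_hom pq0 cX _];
by rewrite !inE eqxx ?orbT.
Qed.

Lemma homogeneous_frame : exists (e : idx -> S) (u : idx -> G),
  (is_frame (cartan_table F) e \/ is_frame (octonion_table F) e) /\
  forall i, homog Gam (u i) (e i).
Proof.
have [[s [s_hom s0]]|no] := pselect (exists s, homog Gam 0 s /\ s != 0).
  by have [e [u [fe ue]]] := hom_cartan s_hom s0; exists e, u; split; first left.
have [s hs|e [u [fe ue]]] := hom_octonion.
  by apply/eqP; apply: contraT => s0; case: no; exists s.
by exists e, u; split; first right.
Qed.

End HomogeneousFrames.

(** * The grading attached to a frame *)

Section SymSquareSpan.
Context {F : fieldType} {V : vectType F}.

(** A class lifts to a coordinate matrix, and elementary matrices are tensors of basis vectors. *)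
Lemma symsq_span (W : {vspace (symsq V)}) :
  (forall x y, sprod x y \in W) -> forall h, h \in W.
Proof.
move=> sW h; rewrite -[h]vclass_valK; set A : tensor V := val h.
have -> : A = \sum_i \sum_j A i j *: tens (vbasis {:V})`_i (vbasis {:V})`_j.
  rewrite {1}[A]matrix_sum_delta; apply: eq_bigr => i _; apply: eq_bigr => j _.
  congr (_ *: _); apply/matrixP => k l; rewrite !mxE.
  rewrite !coord_free ?(basis_free (vbasisP _)) // -natrM mulnb.
  by congr (_%:R); rewrite [k == i]eq_sym [l == j]eq_sym.
rewrite linear_sum memv_suml // => i _; rewrite linear_sum memv_suml // => j _.
by rewrite linearZ memvZ //; apply: sW.
Qed.

End SymSquareSpan.

Lemma span_image (F : fieldType) (U V : vectType F) (f : {linear U -> V})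
    (X : seq U) (Y : {vspace V}) x :
  (forall x, x \in X -> f x \in Y) -> x \in <<X>>%VS -> f x \in Y.
Proof.
move=> fX xX; have /subvP/(_ x xX) : (<<X>> <= linfun f @^-1: Y)%VS.
  by apply/span_subvP => y yX; rewrite -memv_preim lfunE; apply: fX.
by rewrite -memv_preim lfunE.
Qed.

Lemma span_bilinear (F : fieldType) (U V W : vectType F)
    (f : {bilinear U -> V -> W}) (X : seq U) (Y : seq V)
    (Z : {vspace W}) x y :
  (forall x y, x \in X -> y \in Y -> f x y \in Z) ->
  x \in <<X>>%VS -> y \in <<Y>>%VS -> f x y \in Z.
Proof.
move=> fXY xX yY; 
have fl : linear (f^~ y) by move=> a u v; rewrite linearPl.
pose fy : {linear U -> W} := HB.pack (f^~ y) (GRing.isLinear.Build F U W _ (f^~ y) fl).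
rewrite -[f x y]/(fy x); apply: (span_image _ xX) => x' x'X.
by apply: (span_image _ yY) => y' y'Y; apply: fXY.
Qed.

(** * Direct sums from a spanning family with degrees *)

Section ProjectionGrading.
Context {F : fieldType} {V : vectType F} {G : zmodType} {K : finType}.
Variables (X : K -> V) (deg : K -> G) (P : G -> {linear V -> V}).
Hypothesis PX : forall g k, P g (X k) = if deg k == g then X k else 0.
Hypothesis spanX : forall W : {vspace V}, (forall k, X k \in W) -> W = fullv.

Definition spcomp g : {vspace V} := <<[seq X k | k <- enum K & deg k == g]>>%VS.

Definition spsupp : seq G := undup [seq deg k | k <- enum K & X k != 0].

Lemma spcomp_mem k : X k \in spcomp (deg k).
Proof.
by apply/memv_span/mapP; exists k => //; rewrite mem_filter eqxx mem_enum.
Qed.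

Lemma spcompP g (W : {vspace V}) :
  (forall k, deg k = g -> X k \in W) -> (spcomp g <= W)%VS.
Proof.
move=> gW; apply/span_subvP => _ /mapP[k + ->].
by rewrite mem_filter => /andP[/eqP + _]; apply: gW.
Qed.

Lemma mem_spsupp g : (g \in spsupp) = (spcomp g != 0%VS).
Proof.
rewrite mem_undup; apply/mapP/idP => [[k + ->]|].
  rewrite mem_filter => /andP[Xk _]; apply: contraNneq Xk => c0.
  by have := spcomp_mem k; rewrite c0 memv0.
rewrite -subv0; apply: contraNP => nog; apply: spcompP => k kg.
rewrite memv0; apply: contraT => Xk; case: nog.
by exists k; rewrite // mem_filter Xk mem_enum.
Qed.

Lemma spproj g h x : x \in spcomp h -> P g x = if g == h then x else 0.
Proof.
pose f := (linfun (P g) - (if g == h then \1 else 0))%VF.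
have fE y : f y = P g y - (if g == h then y else 0).
  by rewrite /f add_lfunE opp_lfunE lfunE /=; case: eqP; rewrite (id_lfunE, zero_lfunE).
move=> xh; apply: subr0_eq; have /= <- := fE x; apply/eqP; rewrite -memv_ker.
move: x xh; apply/subvP/spcompP => k kh; rewrite memv_ker fE PX kh [h == g]eq_sym.
by case: eqP; rewrite subrr.
Qed.

Lemma spcomp_full : (\sum_(g : seq_sub spsupp) spcomp (val g) = fullv)%VS.
Proof.
apply: spanX => k; have [->|Xk] := eqVneq (X k) 0; first exact: mem0v.
have ks : deg k \in spsupp.
  by rewrite mem_undup; apply/mapP; exists k => //; rewrite mem_filter Xk mem_enum.
by apply: subvP (sumv_sup (SeqSub ks) _ (subvv _)) _ (spcomp_mem k).
Qed.

(** The family may be redundant, as with [sprod (e i) (e j)] and [sprod (e j) (e i)], so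
    independence is read off from the operators [P g] and not from a basis. *)
Lemma spcomp_direct : directv (\sum_(g : seq_sub spsupp) spcomp (val g)).
Proof.
apply/directv_sum_independent => us us_in us0 i _.
have := congr1 (P (val i)) us0; rewrite linear0 linear_sum (bigD1 i) //= big1.
  by rewrite (spproj _ (us_in i isT)) eqxx addr0.
move=> j ji; rewrite (spproj _ (us_in j isT)) (inj_eq val_inj) eq_sym.
by rewrite (negPf ji).
Qed.

End ProjectionGrading.

Section FrameGrading.
Context {F : fieldType} {C : cayleyAlg F}.
Hypothesis nz2 : (2%:R : F) != 0.
Local Notation S := (cskew C).
Local Notation H := (symsq S).
Local Notation A := (smirnov C).
Local Notation m := (@cross F C).
Local Notation b := (@dotp F C).

(** These relations are necessary for the frame to be homogeneous with degrees [d] in some grading,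
    by [homog_compat], and sufficient, by [fcompM]. *)
Definition compat (T : table F) (G : zmodType) (d : idx -> G) : Prop :=
  (forall i j, tcoef T i j != 0 -> d i + d j = d (tprod T i j)) /\
  (forall i, d i + d (tdual T i) = 0).

Definition gen (e : idx -> S) (k : idx + idx * idx) : A :=
  match k with
  | inl i => inS (e i)
  | inr (i, j) => inH (sprod (e i) (e j))
  end.

Definition gdeg (G : zmodType) (d : idx -> G) (k : idx + idx * idx) : G :=
  match k with inl i => d i | inr (i, j) => d i + d j end.

Context {G : zmodType} (T : table F) (e : idx -> S) (d : idx -> G).
Hypotheses (fe : is_frame T e) (cd : compat T d).

Lemma gen_span (W : {vspace A}) : (forall k, gen e k \in W) -> W = fullv.
Proof.
move=> gW; apply/eqP; rewrite eqEsubv subvf; apply/subvP => x _.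
rewrite [x]smirnov_split memvD //.
  have : x.1 \in (linfun (@inH F C) @^-1: W)%VS.
    apply: symsq_span => s t.
    rewrite (frame_expand nz2 fe s) (frame_expand nz2 fe t).
    rewrite linear_sumlz memv_suml // => i _; rewrite linear_sumr memv_suml // => j _.
    rewrite linearZl_LR linearZr_LR /= !memvZ // -memv_preim lfunE.
    exact: (gW (inr (i, j))).
  by rewrite -memv_preim lfunE.
rewrite (frame_expand nz2 fe x.2) linear_sum memv_suml // => i _.
by rewrite linearZ memvZ //; apply: (gW (inl i)).
Qed.

Section FrameForms.
Variables (W : vectType F) (w : idx -> idx -> W).

(** Bilinear maps with arbitrary values on pairs of frame vectors. The symmetric ones descend to H
    through [slift], which stands in for a basis of H. *)
Definition fbil (x y : S) : W :=
  \sum_i \sum_j (fcoord T e i x * fcoord T e j y) *: w i j.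

Fact fbil_bilinear : bilinear_for *:%R *:%R fbil.
Proof.
split=> z a x y; rewrite /fbil -[RHS]/(a *: _ + _) scaler_sumr -big_split;
apply: eq_bigr => i _ /=;
rewrite scaler_sumr -big_split; apply: eq_bigr => j _ /=;
rewrite scalerA -scalerDl linearP; congr (_ *: _) => /=; ring.
Qed.

Fact fbilC x y : (forall i j, w i j = w j i) -> fbil x y = fbil y x.
Proof.
move=> wC; rewrite /fbil exchange_big /=.
by apply: eq_bigr => i _; apply: eq_bigr => j _; rewrite mulrC wC.
Qed.

Lemma fbil_frame i j : fbil (e i) (e j) = w i j.
Proof.
rewrite /fbil (bigD1 i) //= [X in _ + X]big1 ?addr0 => [|k /negPf ki]; last first.
  by rewrite big1 // => l _; rewrite (fcoord_frame fe) ki mul0r scale0r.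
rewrite (bigD1 j) //= !(fcoord_frame fe) !eqxx mulr1 scale1r big1 ?addr0 //.
by move=> l /negPf lj; rewrite !(fcoord_frame fe) lj mulr0 scale0r.
Qed.

End FrameForms.

Definition symproj g : S -> S -> H :=
  fbil (fun i j => if d i + d j == g then sprod (e i) (e j) else 0).

Definition genproj g (x : A) : A :=
  (slift (symproj g) x.1, \sum_(i | d i == g) fcoord T e i x.2 *: e i).

Fact genproj_linear g : linear (genproj g).
Proof.
apply: lin_pair => a x y; first by rewrite linearP.
rewrite scaler_sumr -big_split; apply: eq_bigr => i _ /=.
by rewrite linearP scalerDl scalerA.
Qed.
HB.instance Definition _ g :=
  GRing.isLinear.Build F A A _ (genproj g) (genproj_linear g).

Lemma genproj_gen g k : genproj g (gen e k) = if gdeg d k == g then gen e k else 0.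
Proof.
case: k => [i|[i j]] /=; rewrite /genproj /=.
  rewrite linear0; case: eqP => dg.
    rewrite (bigD1 i) /=; last exact/eqP.
    rewrite (fcoord_frame fe) eqxx scale1r big1 ?addr0 // => j /andP[_ /negPf ji].
    by rewrite (fcoord_frame fe) ji scale0r.
  rewrite big1 // => j /eqP dj; rewrite (fcoord_frame fe).
  by case: eqP dj => [->|]; rewrite // scale0r.
rewrite sliftE => [||x y]; last 2 first.
- exact: fbil_bilinear.
- by apply: fbilC => k l; rewrite addrC sprodC.
rewrite big1 => [|l _]; last by rewrite linear0 scale0r.
by rewrite /symproj fbil_frame; case: eqP.
Qed.

Definition fcomp : G -> {vspace A} := spcomp (gen e) (gdeg d).

Lemma inS_fcomp i : inS (e i) \in fcomp (d i).
Proof. exact: (spcomp_mem (gen e) (gdeg d) (inl i)). Qed.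

Lemma inH_fcomp i j : inH (sprod (e i) (e j)) \in fcomp (d i + d j).
Proof. exact: (spcomp_mem (gen e) (gdeg d) (inr (i, j))). Qed.

(** Together with [dotp_frame], all that [fcompM] has to know about the table. *)
Lemma cross_frame i j : m (e i) (e j) = 0 \/
  exists c k, m (e i) (e j) = c *: e k /\ d k = d i + d j.
Proof.
rewrite fe.1; have [->|c0] := eqVneq (tcoef T i j) 0; first by left; rewrite scale0r.
by right; exists (tcoef T i j), (tprod T i j); rewrite (cd.1 _ _ c0).
Qed.

Lemma dotp_frame i j : b (e i) (e j) = 0 \/ d i + d j = 0.
Proof.
rewrite fe.2; case: eqP => [->|_]; last by left.
by right; apply: cd.2.
Qed.

Lemma cross_fcomp i j : inS (m (e i) (e j)) \in fcomp (d i + d j).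
Proof.
have [->|[c [k [-> <-]]]] := cross_frame i j; first by rewrite linear0 mem0v.
by rewrite linearZ memvZ // inS_fcomp.
Qed.

Lemma crossH_fcomp i j k :
  inH (sprod (m (e i) (e j)) (e k)) \in fcomp (d i + d j + d k).
Proof.
have [->|[c [l [-> <-]]]] := cross_frame i j; first by rewrite linear0l linear0 mem0v.
by rewrite linearZl_LR linearZ memvZ // inH_fcomp.
Qed.

Lemma crossHH_fcomp i j k l :
  inH (sprod (m (e i) (e j)) (m (e k) (e l))) \in fcomp (d i + d j + (d k + d l)).
Proof.
have [->|[c [p [-> <-]]]] := cross_frame i j; first by rewrite linear0l linear0 mem0v.
have [->|[c' [q [-> <-]]]] := cross_frame k l; first by rewrite linear0r linear0 mem0v.
by rewrite linearZl_LR linearZr_LR !linearZ /= !memvZ // inH_fcomp.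
Qed.

Lemma dotpZ_fcomp c i j g x : x \in fcomp g ->
  (c * b (e i) (e j)) *: x \in fcomp (d i + d j + g).
Proof.
move=> xg; have [->|->] := dotp_frame i j; first by rewrite mulr0 scale0r mem0v.
by rewrite add0r memvZ.
Qed.

Lemma dotSH_fcomp i j k :
  inS (dotSH (e i) (e j) (e k)) \in fcomp (d i + d j + d k).
Proof.
rewrite dotSHE // linearB linearD !linearZ /= -mulNr memvB //.
  by rewrite -addrA addrC dotpZ_fcomp // inS_fcomp.
rewrite -[b (e i) (e j)]mul1r -[b (e i) (e k)]mul1r memvD //.
  by rewrite dotpZ_fcomp // inS_fcomp.
by rewrite addrAC dotpZ_fcomp // inS_fcomp.
Qed.

Lemma brkSH_fcomp i j k :
  inH (sprod (m (e i) (e j)) (e k) + sprod (e j) (m (e i) (e k)))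
    \in fcomp (d i + d j + d k).
Proof.
rewrite linearD memvD // ?crossH_fcomp // sprodC addrAC.
exact: crossH_fcomp.
Qed.

Lemma dotHH_fcomp i j k l :
  inH (dotHH (e i) (e j) (e k) (e l)) \in fcomp (d i + d j + (d k + d l)).
Proof.
rewrite dotHHE // !linearB linearD /= ![inH (_ *: _)]linearZ /= !memvB ?memvD //.
- by rewrite [d i + d j + _](AC (2*2) ((1*3)*(2*4))) crossHH_fcomp.
- by rewrite [d i + d j + _](AC (2*2) ((1*4)*(2*3))) crossHH_fcomp.
- by rewrite dotpZ_fcomp // inH_fcomp.
- by rewrite addrC dotpZ_fcomp // inH_fcomp.
Qed.

Lemma brkHH_fcomp i j k l :
  inS (2%:R^-1 *: brkHH (e i) (e j) (e k) (e l)) \in fcomp (d i + d j + (d k + d l)).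
Proof.
have t p q r s :
    inS (b (e p) (e q) *: m (e r) (e s)) \in fcomp (d p + d q + (d r + d s)).
  by rewrite linearZ /= -[b _ _]mul1r dotpZ_fcomp // cross_fcomp.
rewrite brkHHE linearN /= memvN !linearD /= !memvD //.
- by rewrite [d i + d j + _](AC (2*2) ((1*3)*(2*4))) t.
- by rewrite [d i + d j + _](AC (2*2) ((1*4)*(2*3))) t.
- by rewrite [d i + d j + _](AC (2*2) ((2*3)*(1*4))) t.
- by rewrite [d i + d j + _](AC (2*2) ((2*4)*(1*3))) t.
Qed.

Lemma fcompM g h x y : x \in fcomp g -> y \in fcomp h -> ia_mul A x y \in fcomp (g + h).
Proof.
apply: span_bilinear => _ _ /mapP[k + ->] /mapP[l + ->].
rewrite !mem_filter => /andP[/eqP <- _] /andP[/eqP <- _].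
case: k l => [i|[i j]] [k|[k l]] /=.
- by rewrite mulSS memvD // ?inH_fcomp ?cross_fcomp.
- by rewrite mulSH addrA memvD // ?brkSH_fcomp ?dotSH_fcomp.
- by rewrite mulHS [d i + d j + _]addrC addrA memvD // ?memvN ?brkSH_fcomp ?dotSH_fcomp.
- by rewrite mulHH // memvD // ?dotHH_fcomp ?brkHH_fcomp.
Qed.

Lemma fcomp_inv g x : x \in fcomp g -> ia_inv A x \in fcomp g.
Proof.
apply: span_image => _ /mapP[k + ->]; rewrite mem_filter => /andP[/eqP <- _].
have := spcomp_mem (gen e) (gdeg d) k; case: k => [i|[i j]] kg.
  have -> : ia_inv A (inS (e i)) = inS (- e i) by [].
  by rewrite linearN memvN.
suff -> : ia_inv A (inH (sprod (e i) (e j))) = inH (sprod (e i) (e j)) by [].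
by congr pair; rewrite /= oppr0.
Qed.

Definition frame_grading : grading A G :=
  @Grading F A G fcomp (spsupp (gen e) (gdeg d)) (undup_uniq _)
    (mem_spsupp (gen e) (gdeg d)) (spcomp_full (gdeg d) gen_span)
    (spcomp_direct genproj_gen) fcompM fcomp_inv.

End FrameGrading.

(** * Equivalences *)

Lemma eq_spsupp (F : fieldType) (V : vectType F) (G : zmodType) (K : finType)
    (X Y : K -> V) (deg : K -> G) :
  (forall k, (X k == 0) = (Y k == 0)) -> spsupp X deg = spsupp Y deg.
Proof.
by move=> XY; rewrite /spsupp; under eq_filter do rewrite XY.
Qed.

Section CoarseningEquivalence.
Context {F : fieldType} {A : invAlg F}.

(** A strict inclusion would make the refinement proper. [psi] reaches all of the support: a nonzero
    vector of degree h expands into parts of degrees psi(g), one of which must be h. *)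
Lemma refinement_degree_map (G G' : zmodType) (Gam : grading A G)
    (Gam' : grading A G') (psi : G' -> G) :
  (forall g, (Gam' g <= Gam (psi g))%VS) -> ~ proper_refinement Gam Gam' ->
  {in gsupp Gam', forall g, Gam' g = Gam (psi g)} /\
  perm_eq (map psi (gsupp Gam')) (gsupp Gam).
Proof.
move=> le not_proper.
have eqG : {in gsupp Gam', forall g, Gam' g = Gam (psi g)}.
  move=> g gs; apply/eqP; apply: contraT => ne; case: not_proper; split.
    by move=> g'; exists (psi g').
  by exists g, (psi g).
split=> //; apply: uniq_perm (gsupp_uniq Gam) _.
  rewrite map_inj_in_uniq ?gsupp_uniq // => g h gs hs e.
  have := gs; rewrite mem_gsupp -vpick0 => g0.
  apply: degree_unique (memv_pick _) _ g0.
  by rewrite eqG // e -eqG // memv_pick.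
move=> h; apply/mapP/idP => [[g gs ->]|hs].
  by rewrite mem_gsupp -eqG // -mem_gsupp.
have := hs; rewrite mem_gsupp -vpick0; set x := vpick _ => x0.
have xh : x \in Gam h by apply: memv_pick.
have /existsP[u uh] : [exists u : usupp Gam', psi (val u) == h].
  apply: contraT; rewrite negb_exists => /forallP noh; case/eqP: x0.
  have := gproj_hom h xh; rewrite eqxx => <-.
  rewrite [x](gproj_sum Gam') linear_sum big1 // => u _ /=.
  rewrite (gproj_hom h (subvP (le _) _ (gproj_mem _ _ _))) eq_sym.
  by rewrite (negPf (noh u)).
by exists (val u); [apply: valP|rewrite (eqP uh)].
Qed.

Lemma equivalent_sym (G G' : zmodType) (Gam : grading A G) (Gam' : grading A G') :
  equivalent Gam Gam' -> equivalent Gam' Gam.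
Proof.
move=> [f [alpha [[fbij fM fI] perm fG]]].
have fker : lker f == 0%VS by apply/lker0P/bij_inj.
have fK := lker0_lfunK fker; have fVK := lker0_lfunVK fker.
have alpha_inj : {in gsupp Gam &, injective alpha}.
  move=> g h gs hs e; have gh : Gam g = Gam h.
    by apply/eqP; rewrite -(eq_limg_ker0 _ _ fker) !fG // e.
  have := gs; rewrite mem_gsupp -vpick0 => g0.
  by apply: degree_unique (memv_pick _) _ g0; rewrite gh memv_pick.
(* [alpha] is known to be injective only on the support, so it is inverted there and the inverse
   extended by 0. *)
pose beta h := if [pick u : usupp Gam | alpha (val u) == h] is Some u then val u else 0.
have alphaK : {in gsupp Gam, cancel alpha beta}.
  move=> g gs; rewrite /beta; case: pickP => [u /eqP e|/(_ (SeqSub gs))];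
    last by rewrite eqxx.
  by apply: alpha_inj => //; apply: valP.
exists (f^-1)%VF, beta; split.
- split; first by exists f.
    by move=> x y; apply: (bij_inj fbij); rewrite fM !fVK.
  by move=> x; apply: (bij_inj fbij); rewrite fI !fVK.
- apply: (@perm_trans _ (map beta (map alpha (gsupp Gam)))).
    by rewrite perm_map // perm_sym.
  by rewrite -map_comp map_id_in.
- move=> h; rewrite -(perm_mem perm) => /mapP[g gs ->]; rewrite alphaK // -fG //.
  by rewrite -limg_comp lker0_compVf // lim1g.
Qed.

End CoarseningEquivalence.

(** * Automorphisms from pairs of frames *)

Section FrameMaps.
Context {F : fieldType} {C : cayleyAlg F}.
Hypothesis nz2 : (2%:R : F) != 0.
Local Notation S := (cskew C).
Local Notation A := (smirnov C).
Local Notation m := (@cross F C).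
Local Notation b := (@dotp F C).

Lemma gen_ext (T : table F) (e : idx -> S) (V : vectType F) (f g : A -> V) :
  is_frame T e -> linear f -> linear g ->
  (forall k, f (gen e k) = g (gen e k)) -> f =1 g.
Proof.
move=> fe fl gl fg x.
pose h y := f y - g y.
have hl : linear h by apply: lin_add => //; apply: lin_opp.
pose h' : {linear A -> V} := HB.pack h (GRing.isLinear.Build F A V _ h hl).
have /eqP kh : lker (linfun h') == fullv.
  by apply/eqP/(gen_span nz2 fe) => k; rewrite memv_ker lfunE /= /h fg subrr.
have := memvf x; rewrite -kh memv_ker lfunE /= /h subr_eq0.
by move/eqP.
Qed.

Variable T : table F.

Definition frame_map (e e' : idx -> S) (s : S) : S := \sum_i fcoord T e i s *: e' i.

Fact frame_map_linear e e' : linear (frame_map e e').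
Proof.
move=> a x y; rewrite /frame_map scaler_sumr -big_split; apply: eq_bigr => i _ /=.
by rewrite linearP scalerDl scalerA.
Qed.
HB.instance Definition _ e e' :=
  GRing.isLinear.Build F S S _ (frame_map e e') (frame_map_linear e e').

Definition smirnov_map (e e' : idx -> S) (x : A) : A :=
  (slift (fun s t => sprod (frame_map e e' s) (frame_map e e' t)) x.1,
   frame_map e e' x.2).

Fact smirnov_map_linear e e' : linear (smirnov_map e e').
Proof. by apply: lin_pair => a x y; rewrite linearP. Qed.
HB.instance Definition _ e e' :=
  GRing.isLinear.Build F A A _ (smirnov_map e e') (smirnov_map_linear e e').

Section TwoFrames.
Variables (e e' : idx -> S).
Hypotheses (fe : is_frame T e) (fe' : is_frame T e').
Local Notation phi := (frame_map e e').
Local Notation Phi := (smirnov_map e e').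

Lemma frame_mapE i : phi (e i) = e' i.
Proof.
rewrite /frame_map (bigD1 i) //= (fcoord_frame fe) eqxx scale1r big1 ?addr0 //.
by move=> j /negPf ji; rewrite (fcoord_frame fe) ji scale0r.
Qed.

Lemma smirnov_map_inS s : Phi (inS s) = inS (phi s).
Proof. by rewrite /smirnov_map /= linear0. Qed.

Lemma smirnov_map_inH s t : Phi (inH (sprod s t)) = inH (sprod (phi s) (phi t)).
Proof.
rewrite /smirnov_map /= linear0 sliftE // => [|x y]; last exact: sprodC.
by split=> z a x y; rewrite linearP /= ?linearPl ?linearPr.
Qed.

Lemma frame_map_cross i j : phi (m (e i) (e j)) = m (e' i) (e' j).
Proof. by rewrite fe.1 linearZ /= frame_mapE fe'.1. Qed.

Lemma frame_map_dotp i j : b (e' i) (e' j) = b (e i) (e j).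
Proof. by rewrite fe.2 fe'.2. Qed.

Lemma smirnov_map_gen k : Phi (gen e k) = gen e' k.
Proof.
by case: k => [i|[i j]] /=; rewrite ?smirnov_map_inS ?smirnov_map_inH !frame_mapE.
Qed.

(** The common table makes [phi] preserve [cross] and [dotp] on frame vectors, and every product of
    generators of T(C) is written in these. *)
Lemma smirnov_mapM x y : Phi (ia_mul A x y) = ia_mul A (Phi x) (Phi y).
Proof.
have dSH i j k : phi (dotSH (e i) (e j) (e k)) = dotSH (e' i) (e' j) (e' k).
  by rewrite !dotSHE // !(linearB, linearD, linearZ) /= !frame_mapE -!frame_map_dotp.
have PhiE h s : Phi (inH h + inS s) = Phi (inH h) + inS (phi s).
  by rewrite linearD /= smirnov_map_inS.
have PhiB i j k :
    Phi (inH (sprod (m (e i) (e j)) (e k) + sprod (e j) (m (e i) (e k)))) =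
    inH (sprod (m (e' i) (e' j)) (e' k) + sprod (e' j) (m (e' i) (e' k))).
  rewrite !linearD /= !smirnov_map_inH.
  by rewrite !frame_mapE !frame_map_cross.
have onto k l : Phi (ia_mul A (gen e k) (gen e l)) = ia_mul A (gen e' k) (gen e' l).
  case: k l => [i|[i j]] [k|[k l]].
  - by rewrite !mulSS PhiE smirnov_map_inH !frame_mapE frame_map_cross.
  - by rewrite !mulSH PhiE PhiB dSH.
  - by rewrite !mulHS linearD linearN /= smirnov_map_inS PhiB dSH.
  - rewrite !mulHH PhiE !brkHHE; congr (_ + inS _).
      rewrite !dotHHE // !linearB !linearD /= ![inH (_ *: _)]linearZ /=.
      rewrite ![Phi (_ *: _)]linearZ /= !smirnov_map_inH.
      by rewrite !frame_mapE !frame_map_cross -!frame_map_dotp.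
    rewrite linearN !linearD !linearZ /= !frame_map_cross.
    by rewrite -!frame_map_dotp.
have lmul (V : vectType F) (f : {linear A -> V}) z : linear (fun x => f (ia_mul A x z)).
  by move=> a u v; rewrite linearPl linearP.
have rmul (V : vectType F) (f : {linear A -> V}) z : linear (fun x => f (ia_mul A z x)).
  by move=> a u v; rewrite linearPr linearP.
apply: (gen_ext (f := fun x => Phi (ia_mul A x y))
  (g := fun x => ia_mul A (Phi x) (Phi y)) fe) => [||k].
- exact: lmul.
- by move=> a u v; rewrite linearP linearPl.
apply: (gen_ext (f := fun y => Phi (ia_mul A (gen e k) y))
  (g := fun y => ia_mul A (Phi (gen e k)) (Phi y)) fe) => [||l].
- exact: rmul.
- by move=> a u v; rewrite linearP linearPr.
by rewrite onto !smirnov_map_gen.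
Qed.

Lemma smirnov_mapI x : Phi (ia_inv A x) = ia_inv A (Phi x).
Proof. by congr pair; rewrite /= linearN. Qed.

End TwoFrames.

Lemma smirnov_mapK (e e' : idx -> S) : is_frame T e -> is_frame T e' ->
  cancel (smirnov_map e e') (smirnov_map e' e).
Proof.
move=> fe fe'.
apply: (gen_ext (g := id) fe) => [||k] //.
  by move=> a x y; rewrite !linearP.
by rewrite (smirnov_map_gen _ fe) (smirnov_map_gen _ fe').
Qed.

Lemma smirnov_map_aut (e e' : idx -> S) : is_frame T e -> is_frame T e' ->
  ia_aut (linfun (smirnov_map e e')).
Proof.
move=> fe fe'; split.
- by exists (smirnov_map e' e) => x;
    rewrite lfunE /= (smirnov_mapK fe fe', smirnov_mapK fe' fe).
- by move=> x y; rewrite !lfunE /= (smirnov_mapM fe fe').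
- by move=> x; rewrite !lfunE /= smirnov_mapI.
Qed.

Lemma smirnov_map_fcomp (G : zmodType) (d : idx -> G) (e e' : idx -> S) g :
  is_frame T e ->
  (linfun (smirnov_map e e') @: fcomp e d g)%VS = fcomp e' d g.
Proof.
move=> fe; rewrite /fcomp /spcomp limg_span -map_comp; congr <<_>>%VS.
by apply: eq_map => k /=; rewrite lfunE /= smirnov_map_gen.
Qed.

Lemma spsupp_frames (G : zmodType) (d : idx -> G) (e e' : idx -> S) :
  is_frame T e -> is_frame T e' ->
  spsupp (gen e) (gdeg d) = spsupp (gen e') (gdeg d).
Proof.
move=> fe fe'; apply: eq_spsupp => k; rewrite -(smirnov_map_gen e' fe k).
apply/eqP/eqP => [->|e0]; first exact: linear0.
have := smirnov_mapK fe fe' (gen e k); rewrite e0 => <-; exact: linear0.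
Qed.

End FrameMaps.

(** * Universal groups *)

Section UniversalGroupTheory.
Local Open Scope quotient_scope.
Context {F : fieldType} {A : invAlg F} {G : zmodType} (Gam : grading A G).
Local Notation I := (@urels F A G Gam).
Local Notation U := (universal_group Gam).

Definition uproj (x : ufree Gam) : U := \pi_(Quotient.quot I) x.

Fact uproj_is_zmod_morphism : zmod_morphism uproj.
Proof. by move=> x y; apply: (raddfB (\pi_(Quotient.quot I) : {additive _ -> _})). Qed.
HB.instance Definition _ :=
  GRing.isZmodMorphism.Build (ufree Gam) U uproj uproj_is_zmod_morphism.

Lemma uproj_repr (q : U) : uproj (repr (q : Quotient.quot I)) = q.
Proof. exact: reprK. Qed.

Lemma uprojP x y : uproj x = uproj y -> in_urels (x - y).
Proof. by move=> /eqP; rewrite /uproj -Quotient.idealrBE => /asboolP. Qed.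

Lemma uproj_rel u : in_urels u -> uproj u = 0.
Proof.
move=> ru; rewrite -(raddf0 uproj); apply/eqP.
by rewrite /uproj -Quotient.idealrBE subr0; apply/asboolP.
Qed.

Lemma ufreeE (x : ufree Gam) : x = \sum_u ugen u *~ x u.
Proof.
apply/ffunP => v; rewrite sum_ffunE (bigD1 v) //= big1 ?addr0 => [|u /negPf uv].
  by rewrite ffunMzE ffunE eqxx intz.
by rewrite ffunMzE ffunE eq_sym uv mul0rz.
Qed.

Definition uclass (g : G) : U :=
  if insub g is Some u then uproj (ugen (u : usupp Gam)) else 0.

Lemma uclassE (u : usupp Gam) : uclass (val u) = uproj (ugen u).
Proof. by rewrite /uclass valK. Qed.

(** The nonzero product puts [g + h] in the support, so the equation is one of the defining
    relations. *)
Lemma uclassD g h x y : x \in Gam g -> y \in Gam h -> ia_mul A x y != 0 ->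
  uclass g + uclass h = uclass (g + h).
Proof.
move=> xg yh xy.
have x0 : x != 0 by apply: contraNneq xy => ->; rewrite linear0l.
have y0 : y != 0 by apply: contraNneq xy => ->; rewrite linear0r.
pose u : usupp Gam := SeqSub (gsupp_neq0 xg x0).
pose v : usupp Gam := SeqSub (gsupp_neq0 yh y0).
pose w : usupp Gam := SeqSub (gsupp_neq0 (gcompM xg yh) xy).
rewrite -[g]/(val u) -[h]/(val v) -[val u + val v]/(val w) !uclassE.
apply/eqP; rewrite -subr_eq0 -raddfD -raddfB; apply/eqP/uproj_rel/in_urelsG.
by split; [exists x, y|move=> x' y' /gcompM]; last exact.
Qed.

Lemma urelD (u v w : usupp Gam) : urel u v w -> val u + val v = val w.
Proof.
move=> [[x [y [xu yv xy]]] uvw].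
by apply: degree_unique (gcompM xu yv) (uvw _ _ xu yv) xy.
Qed.

(** The second hypothesis expresses that the support generates [G] as far as endomorphisms can tell;
    it makes the composite G -> U -> G the identity. *)
Lemma universal_group_iso (psi : {additive G -> U}) :
  (forall g, g \in gsupp Gam -> psi g = uclass g) ->
  (forall f : {additive G -> G}, {in gsupp Gam, f =1 id} -> f =1 id) ->
  zmod_isomorphic U G.
Proof.
move=> psiE rigid.
pose phi0 (x : ufree Gam) : G := \sum_u val u *~ x u.
have phi0B : zmod_morphism phi0.
  move=> x y; rewrite /phi0 -sumrB; apply: eq_bigr => u _.
  by rewrite !ffunE mulrzBr.
pose phi0a : {additive ufree Gam -> G} :=
  HB.pack phi0 (GRing.isZmodMorphism.Build _ _ phi0 phi0B).
have phi0D x y : phi0 (x + y) = phi0 x + phi0 y := raddfD phi0a x y.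
have phi0_gen u : phi0 (ugen u) = val u.
  rewrite /phi0 (bigD1 u) //= ffunE eqxx big1 ?addr0 // => v /negPf vu.
  by rewrite ffunE vu.
have phi0_rel x : in_urels x -> phi0 x = 0.
  elim=> [|u v _ u0 _ v0|g h k ghk]; first exact: (raddf0 phi0a).
    by rewrite phi0B u0 v0 subrr.
  by rewrite phi0B phi0D !phi0_gen (urelD ghk) subrr.
pose phi (q : U) : G := phi0 (repr (q : Quotient.quot I)).
have phiE x : phi (uproj x) = phi0 x.
  apply/eqP; rewrite -subr_eq0 -phi0B; apply/eqP/phi0_rel/uprojP.
  exact: uproj_repr.
have phiB : zmod_morphism phi.
  by move=> p q; rewrite -(uproj_repr p) -(uproj_repr q) -raddfB !phiE phi0B.
pose phia : {additive U -> G} :=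
  HB.pack phi (GRing.isZmodMorphism.Build _ _ phi phiB).
exists phia; exists psi => [q|g] /=.
  rewrite -(uproj_repr q) phiE; set x := repr _; rewrite [in RHS](ufreeE x).
  rewrite /phi0 !raddf_sum; apply: eq_bigr => u _.
  by rewrite !raddfMz psiE; [rewrite (uclassE u)|exact: valP].
pose f : {additive G -> G} := (phia \o psi)%FUN.
have f_id : {in gsupp Gam, f =1 id}.
  move=> h hs; pose u : usupp Gam := SeqSub hs.
  have -> : f h = phi (psi h) by [].
  by rewrite psiE // (uclassE u : uclass h = _) phiE phi0_gen.
exact: (rigid f f_id g).
Qed.

End UniversalGroupTheory.

(** * Classification *)

(* d : idx -> G presents G as the abelian group generated by the degrees of the
   frame elements subject to the relations in compat. *)
Definition universal_degree (F : fieldType) (T : table F) (G : zmodType)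
    (d : idx -> G) : Prop :=
  (forall (V : zmodType) (u : idx -> V), compat T u ->
     exists psi : {additive G -> V}, forall i, psi (d i) = u i) /\
  (forall f : {additive G -> G}, (forall i, f (d i) = d i) -> f =1 id).

Section FrameGradingTheory.
Context {F : fieldType} {C : cayleyAlg F}.
Hypothesis nz2 : (2%:R : F) != 0.
Local Notation S := (cskew C).
Local Notation A := (smirnov C).
Local Notation m := (@cross F C).
Local Notation b := (@dotp F C).
Context {T : table F} {e : idx -> S}.
Hypothesis fe : is_frame T e.

Lemma homog_compat (G : zmodType) (Gam : grading A G) (u : idx -> G) :
  (forall i, homog Gam (u i) (e i)) -> compat T u.
Proof.
move=> uh; split=> [i j cij|i].
  have := hom_cross nz2 (uh i) (uh j); rewrite fe.1 => h.
  apply: hom_uniq h (homZ _ (uh _)) _.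
  by rewrite scaler_eq0 negb_or cij (frame_neq0 fe).
apply: hom_dotp (uh i) (uh _) _ => //.
by rewrite fe.2 eqxx tform_neq0.
Qed.

Lemma fcomp_coarsen (G G' : zmodType) (d : idx -> G) (Gam : grading A G')
    (u : idx -> G') (psi : {additive G -> G'}) :
  (forall i, homog Gam (u i) (e i)) -> (forall i, psi (d i) = u i) ->
  forall g, (fcomp e d g <= Gam (psi g))%VS.
Proof.
move=> uh psiE g; apply: spcompP => -[i|[i j]] /= <-; first by rewrite psiE uh.
by rewrite raddfD /= !psiE hom_sprod.
Qed.

(** Detected by the symmetric form with value 1 on (i, j) and (j, i), lifted to H. *)
Lemma sprod_frame_neq0 i j : sprod (e i) (e j) != 0.
Proof.
pose w k l : F^o := (((k, l) == (i, j)) || ((l, k) == (i, j)))%:R.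
apply/eqP => s0; have := @sliftE F S F^o (fbil T e w) (e i) (e j).
rewrite s0 linear0 => /(_ (fbil_bilinear T e w)).
rewrite (fbil_frame fe) /w eqxx /= => /(_ _)/esym/eqP; rewrite oner_eq0 => h.
by apply: notF; apply: h => x y; apply: fbilC => k l; rewrite orbC.
Qed.

Lemma inH_eq0 (h : symsq S) : (inH h == 0 :> A) = (h == 0).
Proof. by apply/eqP/eqP => [[]|->] //; rewrite linear0. Qed.

(** The H-part survives even where the cross product vanishes, so every pair of frame vectors yields
    a relation in the universal group. *)
Lemma mul_frame_neq0 i j : ia_mul A (inS (e i)) (inS (e j)) != 0.
Proof.
rewrite mulSS; apply: contra (sprod_frame_neq0 i j) => /eqP/(congr1 fst) /= e0.
by rewrite -e0 addr0.
Qed.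

Lemma gen_neq0 k : gen e k != 0.
Proof.
case: k => [i|[i j]] /=; last by rewrite inH_eq0 sprod_frame_neq0.
by apply: contra (frame_neq0 fe i) => /eqP/(congr1 snd) /= ->.
Qed.

Context {G : zmodType} {d : idx -> G}.
Hypothesis cd : compat T d.
Local Notation Gam := (frame_grading nz2 fe cd).

Lemma mem_frame_supp g : g \in gsupp Gam -> exists k, gdeg d k = g.
Proof. by rewrite mem_undup => /mapP[k _ ->]; exists k. Qed.

Lemma frame_supp k : gdeg d k \in gsupp Gam.
Proof.
rewrite mem_undup; apply/mapP; exists k => //.
by rewrite mem_filter gen_neq0 mem_enum.
Qed.

Lemma frame_homog i : homog Gam (d i) (e i).
Proof. exact: inS_fcomp. Qed.

Lemma frame_universal_group : universal_degree T d ->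
  zmod_isomorphic (universal_group Gam) G.
Proof.
move=> [ud rigid].
have cD i j : uclass Gam (d i) + uclass Gam (d j) = uclass Gam (d i + d j).
  exact: uclassD (frame_homog i) (frame_homog j) (mul_frame_neq0 i j).
(* 0 lies in the support, so a relation is required. For e_j dual to e_i, the class of e_i and e_j
   in H has degree 0; for a third index l, its product with e_l has S-part -2 b(e_i, e_j) e_l, which
   is nonzero. *)
have c0 : uclass Gam 0 = 0.
  have [i [j jE]] : exists i j : idx, j = tdual T i by exists None; eexists.
  have [l] : exists l : idx, l \notin [:: i; j].
    have /allPn[l _ l_ij] : ~~ all (mem [:: i; j]) (enum idx); last by exists l.
    apply/negP => /allP all_ij.
    have := uniq_leq_size (enum_uniq idx) all_ij.
    by rewrite -cardE card_idx.
  rewrite !inE negb_or => /andP[li lj].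
  have dij : d i + d j = 0 by rewrite jE; apply: cd.2.
  have x0 : inH (sprod (e i) (e j)) \in Gam 0 by rewrite -dij; apply: inH_fcomp.
  have xl : ia_mul A (inH (sprod (e i) (e j))) (inS (e l)) != 0.
    apply/eqP => /(congr1 snd); rewrite mulHS /= oppr0 add0r dotSHE // !fe.2.
    have [/eqP/negPf -> /eqP/negPf ->] : i <> tdual T l /\ j <> tdual T l.
      by split=> E; [case/eqP: lj; rewrite jE E tdualK
               |case/eqP: li; rewrite -[l](@tdualK F T) -E jE tdualK].
    rewrite jE eqxx !scale0r addr0 subr0 => /eqP; rewrite scaler_eq0 oppr_eq0.
    by rewrite mulf_eq0 (negPf nz2) (negPf (tform_neq0 _ _)) (negPf (frame_neq0 fe _)).
  have := uclassD x0 (frame_homog l) xl; rewrite add0r.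
  by move=> /(canRL (addrK _)) ->; apply: subrr.
have cu : compat T (fun i => uclass Gam (d i)).
  split=> [i j cij|i]; first by rewrite cD (cd.1 _ _ cij).
  by rewrite cD cd.2.
have [psi psiE] := ud _ _ cu.
apply: (universal_group_iso (psi := psi)) => [g /mem_frame_supp[[i|[i j]] <-] /=|f fid].
- exact: psiE.
- by rewrite raddfD /= !psiE cD.
by apply: rigid => i; apply: fid; apply: (frame_supp (inl i)).
Qed.

(** As [d] is injective, the component of degree [d i] meets S in the line of [e i]. So the part of
    [e i] in a component of the refinement, if its i-th coordinate is nonzero, is a multiple of
    [e i], and the frame stays homogeneous. *)
Lemma frame_fine : injective d -> universal_degree T d -> fine Gam.
Proof.
move=> d_inj [ud _] [G' [Gam' [ref [g' [g [g's le ne]]]]]].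
have /choice[u uh] : forall i, exists u, homog Gam' u (e i).
  move=> i.
  have /existsP[v vi] : [exists v : usupp Gam',
      fcoord T e i (sproj Gam' (val v) (e i)) != 0].
    apply: contraT => /existsPn no; have := fcoord_frame fe i i.
    rewrite (sproj_sum Gam' (e i)) linear_sum big1 => [/esym/eqP|v _].
      by rewrite eqxx oner_eq0.
    by apply/eqP; have := no v; rewrite negbK.
  set s := sproj _ _ _ in vi; have sh : homog Gam' (val v) s by apply: sproj_hom.
  have [h le_h] := ref (val v); have sh0 : homog Gam h s by apply: subvP le_h _ sh.
  have sE : s = \sum_j (if h == d j then fcoord T e j s *: e j else 0).
    have := congr1 (sproj Gam h) (frame_expand nz2 fe s).
    rewrite (sproj_id h sh0) eqxx linear_sum => {1}->; apply: eq_bigr => j _.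
    rewrite linearZ /= (sproj_id h (frame_homog j)).
    by case: (h == d j) => //; rewrite scaler0.
  have hdi : h = d i.
    apply/eqP; apply: contraNT vi => ne_h; rewrite sE linear_sum big1 // => j _.
    case: eqP => [hj|_]; last by rewrite linear0.
    rewrite linearZ /= (fcoord_frame fe); case: eqP => [ij|_]; last by rewrite mulr0.
    by rewrite ij hj eqxx in ne_h.
  have sEi : s = fcoord T e i s *: e i.
    rewrite {1}sE (bigD1 i) //= hdi eqxx big1 ?addr0 // => j /negPf ji.
    by rewrite (inj_eq d_inj) eq_sym ji.
  exists (val v); have -> : e i = (fcoord T e i s)^-1 *: s.
    by rewrite {2}sEi scalerA mulVf // scale1r.
  exact: homZ.
have cu := homog_compat uh; have [psi psiE] := ud _ _ cu.
have coarse := fcomp_coarsen uh psiE.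
have := g's; rewrite mem_gsupp -vpick0 => x0.
have g'E : g' = psi g.
  apply: degree_unique (memv_pick _) _ x0.
  exact: subvP (coarse g) _ (subvP le _ (memv_pick _)).
by case/eqP: ne; apply/eqP; rewrite eqEsubv le g'E coarse.
Qed.

End FrameGradingTheory.

Section Classification.
Context {F : fieldType} {C : cayleyAlg F}.
Hypothesis nz2 : (2%:R : F) != 0.
Local Notation S := (cskew C).
Local Notation A := (smirnov C).

(** [Gam'] coarsens the grading of its own frame [e']; being fine, it has the same components, and
    the map of frames carries [e] to [e']. Degrees are mapped from [G] to [G'], hence the use of
    symmetry. *)
Lemma fine_frame_equivalent (T : table F) (e e' : idx -> S) (fe : is_frame T e)
    (fe' : is_frame T e') (G G' : zmodType) (d : idx -> G) (cd : compat T d)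
    (Gam' : grading A G') (u : idx -> G') :
  (forall i, homog Gam' (u i) (e' i)) -> universal_degree T d ->
  fine Gam' -> equivalent Gam' (frame_grading nz2 fe cd).
Proof.
move=> uh [ud _] fineG'; apply: equivalent_sym.
have [psi psiE] := ud _ _ (homog_compat nz2 fe' uh).
pose Gam0 := frame_grading nz2 fe' cd.
have not_proper : ~ proper_refinement Gam' Gam0.
  by move=> pr; apply: fineG'; exists G, Gam0.
have [eqG perm] := refinement_degree_map (Gam' := Gam0)
  (fcomp_coarsen nz2 uh psiE) not_proper.
have suppE : gsupp (frame_grading nz2 fe cd) = gsupp Gam0 := spsupp_frames nz2 d fe fe'.
exists (linfun (smirnov_map T e e')), psi; split.
- exact: (smirnov_map_aut nz2 fe fe').
- by rewrite suppE; exact: perm.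
- move=> g; rewrite suppE => gs; rewrite -(eqG g gs).
  exact: (smirnov_map_fcomp d e' g fe).
Qed.

End Classification.

(** * Universal degrees for the two tables *)

Section DegreeMaps.
Context {G : zmodType}.

Definition cartan_degree (x : 'I_3 -> G) (p : idx) : G :=
  if p is Some (i, v) then if v then - x i else x i else 0.

Definition octonion_degree (x : 'I_3 -> G) (c : G) (p : idx) : G :=
  if p is Some (i, v) then if v then x i + c else x i else c.

Lemma I3_sum_zero (x : 'I_3 -> G) : x 0 + x (0 + 1) + x (0 + 1 + 1) = 0 ->
  forall i, x i + x (i + 1) + x (i + 1 + 1) = 0.
Proof.
move=> x0 i; have [->|->|->] := I3_cases 0 i => //; rewrite !I3_add3.
  by rewrite addrC addrA.
by rewrite -addrA addrC.
Qed.

Lemma cartan_degree_compat (F : fieldType) (x : 'I_3 -> G) :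
  x 0 + x (0 + 1) + x (0 + 1 + 1) = 0 -> compat (cartan_table F) (cartan_degree x).
Proof.
move=> /I3_sum_zero x0; split=> [[[i u]|] [[j v]|]|[[i u]|]] /=;
  rewrite ?eqxx ?addr0 ?add0r //; last by case: u; rewrite /= ?addNr ?subrr.
have xE k : x k + x (k + 1) = - x (k + 1 + 1) by apply/eqP; rewrite -addr_eq0 x0.
have xE2 k : x k + x (k + 1 + 1) = - x (k + 1).
  by apply/eqP; rewrite -addr_eq0 addrAC x0.
have [->|->|->] := I3_cases i j; rewrite ?eqxx ?I3_neq ?I3_third.
- by case: u v => [] [] //=; rewrite ?eqxx // ?addNr ?subrr.
- case: u v => [] [] //=; rewrite ?eqxx // => _.
  by rewrite -opprD xE opprK.
- case: u v => [] [] //=; rewrite ?eqxx // => _.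
  by rewrite -opprD xE2 opprK.
Qed.

Lemma octonion_degree_compat (F : fieldType) (x : 'I_3 -> G) (c : G) :
  (forall g : G, g + g = 0) -> x 0 + x (0 + 1) + x (0 + 1 + 1) = 0 ->
  compat (octonion_table F) (octonion_degree x c).
Proof.
move=> two /I3_sum_zero x0; split=> [[[i u]|] [[j v]|]|[[i u]|]] /=; rewrite ?eqxx //.
- have opp (g : G) : - g = g by apply/eqP; rewrite eq_sym -addr_eq0 two.
  have xE k : x k + x (k + 1) = x (k + 1 + 1) by apply/eqP; rewrite -subr_eq0 opp x0.
  have xE2 k : x k + x (k + 1 + 1) = x (k + 1).
    by apply/eqP; rewrite -subr_eq0 opp addrAC x0.
  have [->|->|->] := I3_cases i j; rewrite ?eqxx ?I3_neq ?I3_third.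
  + case: u v => [] [] //=; rewrite ?eqxx // => _; last by rewrite addrA two add0r.
    by rewrite addrAC two add0r.
  + case: u v => [] [] //= _; rewrite ?[_ + c + _]addrACA ?two ?addr0 ?xE //.
      by rewrite addrAC xE.
    by rewrite addrA xE.
  + case: u v => [] [] //= _; rewrite ?[_ + c + _]addrACA ?two ?addr0 ?xE2 //.
      by rewrite addrAC xE2.
    by rewrite addrA xE2.
- by case: u => //= _; rewrite -addrA two addr0.
- by case: v => //= _; rewrite addrC // -addrA two addr0.
Qed.

End DegreeMaps.

(** The third value is forced by x_0 x x_1 = y_2, of degree opposite to x_2. With their negatives
    these are the short roots of G2. *)
Definition cartan_roots (i : 'I_3) : int * int :=
  if i == 0 then (1, 0) else if i == 0 + 1 then (0, 1) else (-1, -1).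

Definition zdeg : idx -> int * int := cartan_degree cartan_roots.

Definition octonion_roots (i : 'I_3) : 'Z_2 * 'Z_2 * 'Z_2 :=
  if i == 0 then (1, 0, 0) else if i == 0 + 1 then (0, 1, 0) else (1, 1, 0).

Definition z2deg : idx -> 'Z_2 * 'Z_2 * 'Z_2 :=
  octonion_degree octonion_roots (0, 0, 1).

Lemma Z2cube_double (g : 'Z_2 * 'Z_2 * 'Z_2) : g + g = 0.
Proof.
have z2 (x : 'Z_2) : x + x = 0 by apply: val_inj; case: x => [[|[]]].
by case: g => [[p q] r]; rewrite -[LHS]/(p + p, q + q, r + r) !z2.
Qed.

Lemma zdeg_compat (F : fieldType) : compat (cartan_table F) zdeg.
Proof. exact: cartan_degree_compat. Qed.

Lemma z2deg_compat (F : fieldType) : compat (octonion_table F) z2deg.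
Proof. by apply: octonion_degree_compat; [exact: Z2cube_double|apply/eqP]. Qed.

Lemma zdeg_inj : injective zdeg.
Proof.
move=> [[i u]|] [[j v]|] //.
- by case: (I3_cases 0 i) => ->; case: (I3_cases 0 j) => ->; case: u v => [] [].
- by case: (I3_cases 0 i) => ->; case: u.
- by case: (I3_cases 0 j) => ->; case: v.
Qed.

Lemma z2deg_inj : injective z2deg.
Proof.
move=> [[i u]|] [[j v]|] //.
- by case: (I3_cases 0 i) => ->; case: (I3_cases 0 j) => ->; case: u v => [] [].
- by case: (I3_cases 0 i) => ->; case: u.
- by case: (I3_cases 0 j) => ->; case: v.
Qed.

(** The degrees of x_0 and x_1 determine the others: w x x_0 = x_0 makes that of w zero, duality
    gives the y_i, and x_0 x x_1 = y_2 gives x_2. *)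
Lemma zdeg_universal (F : fieldType) : universal_degree (cartan_table F) zdeg.
Proof.
split=> [V u [cu du]|f fd].
  pose x0 := u (Some (0, false)); pose x1 := u (Some (0 + 1, false)).
  pose psi (g : int * int) : V := x0 *~ g.1 + x1 *~ g.2.
  have psiB : zmod_morphism psi.
    by move=> g h; rewrite /psi /= !mulrzBr opprD addrACA.
  pose psia : {additive (int * int)%type -> V} :=
    HB.pack psi (GRing.isZmodMorphism.Build _ _ psi psiB).
  exists psia.
  have uN i : u (Some (i, true)) = - u (Some (i, false)).
    by apply/eqP; rewrite -addr_eq0 addrC; apply/eqP/(du (Some (i, false))).
  have u0 : u None = 0.
    have := cu None (Some (0, false)) (oner_neq0 F).
    by move/(canRL (addrK _)) => ->; apply: subrr.
  have u2 : u (Some (0 + 1 + 1, false)) = - x0 - x1.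
    have := cu (Some (0, false)) (Some (0 + 1, false)).
    rewrite /= I3_third uN mulr1 /cyc_sign eqxx.
    by move=> /(_ (oner_neq0 F)) h; rewrite -opprD h opprK.
  case=> [[i v]|]; last by rewrite u0; apply: (raddf0 psia).
  have ui : psi (cartan_roots i) = u (Some (i, false)).
    have [->|->|->] := I3_cases 0 i.
    - by rewrite /psi mulr1z mulr0z addr0.
    - by rewrite /psi mulr0z mulr1z add0r.
    - by rewrite u2 /psi !mulrN1z.
  by case: v => //=; rewrite uN -ui; apply: (raddfN psia).
case=> p q.
have -> : (p, q) = zdeg (Some (0, false)) *~ p + zdeg (Some (0 + 1, false)) *~ q.
  by apply: injective_projections; rewrite raddfD !raddfMz /= intz mul0rz ?addr0 ?add0r.
by rewrite raddfD !raddfMz !fd.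
Qed.

(** Frame vectors are self-dual, so 2 u_i = 0 and the representatives 0, 1 of residues can be used
    as natural multiples. The degrees of x_0, x_1 and c determine the rest. *)
Lemma z2deg_universal (F : fieldType) : universal_degree (octonion_table F) z2deg.
Proof.
split=> [V u [cu du]|f fd].
  pose x0 := u (Some (0, false)); pose x1 := u (Some (0 + 1, false)); pose c := u None.
  have two i : u i + u i = 0 by apply: (du i).
  pose psi (g : 'Z_2 * 'Z_2 * 'Z_2) : V := x0 *+ g.1.1 + x1 *+ g.1.2 + c *+ g.2.
  have oppu i : - u i = u i by apply/eqP; rewrite eq_sym -addr_eq0 two.
  have mB i (p q : 'Z_2) : u i *+ (p - q)%R = u i *+ p - u i *+ q.
    by case: p q => [[|[]] //= ?] [[|[]] //= ?];
      rewrite /= ?mulr1n ?mulr0n ?subrr ?subr0 ?sub0r ?oppu.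
  have psiB : zmod_morphism psi.
    move=> g h; rewrite /psi /= !mB !opprD.
    by rewrite (addrACA (x0 *+ _)) (addrACA (_ + _)).
  pose psia : {additive ('Z_2 * 'Z_2 * 'Z_2)%type -> V} :=
    HB.pack psi (GRing.isZmodMorphism.Build _ _ psi psiB).
  exists psia.
  have nz1 : (-1 : F) != 0 by rewrite oppr_eq0 oner_eq0.
  have uT i : u (Some (i, true)) = u (Some (i, false)) + c.
    by have := cu (Some (i, false)) None (oner_neq0 F).
  have u2 : u (Some (0 + 1 + 1, false)) = x0 + x1.
    have := cu (Some (0, false)) (Some (0 + 1, false)).
    rewrite /= I3_third /cyc_sign eqxx.
    by move=> /(_ (oner_neq0 F)) ->.
  have uc : psi (0, 0, 1) = c by rewrite /psi /= !mulr0n !add0r.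
  case=> [[i v]|]; last exact: uc.
  have ui : psi (octonion_roots i) = u (Some (i, false)).
    have [->|->|->] := I3_cases 0 i.
    - by rewrite /psi mulr1n !mulr0n !addr0.
    - by rewrite /psi !mulr0n mulr1n add0r addr0.
    - by rewrite u2 /psi !mulr1n mulr0n addr0.
  by case: v => //=; rewrite uT -ui -uc; apply: (raddfD psia).
case=> [[p q] r].
have -> : (p, q, r) = z2deg (Some (0, false)) *+ p + z2deg (Some (0 + 1, false)) *+ q
    + z2deg None *+ r.
  by case: p q r => [[|[]] //= ?] [[|[]] //= ?] [[|[]] //= ?]; apply/eqP.
by rewrite !raddfD !raddfMn !fd.
Qed.

(** Equivalent gradings have supports of equal size: here at least 9 against at most 8. *)
Lemma cartan_octonion_not_equivalent (F : fieldType) (A : invAlg F)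
    (Gam : grading A (int * int)%type) (Gam' : grading A ('Z_2 * 'Z_2 * 'Z_2)%type) :
  (forall k, gdeg zdeg k \in gsupp Gam) -> ~ equivalent Gam Gam'.
Proof.
move=> supp [f [alpha [_ /perm_size + _]]]; rewrite size_map => sizeE.
have small : (size (gsupp Gam') <= 8)%N.
  pose T : finType := ('Z_2 * 'Z_2 * 'Z_2)%type.
  have := @uniq_leq_size T _ (enum T) (gsupp_uniq Gam').
  by rewrite -cardE !card_prod !card_ord; apply=> g _; rewrite mem_enum.
pose i0 : idx := Some (0, false); pose i1 : idx := Some (0 + 1, false).
(* The seven degrees occurring in S, and twice those of x_0 and x_1. *)
pose ks : seq (idx + idx * idx) :=
  [:: inl None; inl i0; inl i1; inl (Some (0, true)); inl (Some (0 + 1, true));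
      inl (Some (0 + 1 + 1, false)); inl (Some (0 + 1 + 1, true));
      inr (i0, i0); inr (i1, i1)].
have ks_uniq : uniq (map (gdeg zdeg) ks) by [].
have := uniq_leq_size ks_uniq (s2 := gsupp Gam); rewrite sizeE => big.
suff /big/leq_trans/(_ small) : {subset map (gdeg zdeg) ks <= gsupp Gam} by [].
by move=> _ /mapP[k _ ->]; apply: supp.
Qed.

Theorem theorem4p8 (F : closedFieldType) (char_not2 : 2%N \notin [pchar F])
    (C : cayleyAlg F) :
  exists (G1 G2 : zmodType)
         (Gam1 : grading (smirnov C) G1) (Gam2 : grading (smirnov C) G2),
    [/\ fine Gam1, fine Gam2, ~ equivalent Gam1 Gam2,
        (forall (G : zmodType) (Gam : grading (smirnov C) G),
           fine Gam -> equivalent Gam Gam1 \/ equivalent Gam Gam2)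
      & zmod_isomorphic (universal_group Gam1) (int * int)%type /\
        zmod_isomorphic (universal_group Gam2) ('Z_2 * 'Z_2 * 'Z_2)%type].
Proof.
have nz2 : (2%:R : F) != 0 by move: char_not2; rewrite inE.
have [e fe] := exists_cartan_frame (C := C) nz2.
have [e' fe'] := exists_octonion_frame (C := C) nz2.
have uz := zdeg_universal F; have uz2 := z2deg_universal F.
exists (int * int)%type, ('Z_2 * 'Z_2 * 'Z_2)%type.
exists (frame_grading nz2 fe (zdeg_compat F)), (frame_grading nz2 fe' (z2deg_compat F)).
split.
- exact: frame_fine zdeg_inj uz.
- exact: frame_fine z2deg_inj uz2.
- by apply: cartan_octonion_not_equivalent => k;
    apply: (frame_supp nz2 fe (zdeg_compat F)).
- move=> G Gam fineG.
  have [f [u [[ff|ff] uh]]] := homogeneous_frame nz2 Gam; [left|right].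
    exact: (fine_frame_equivalent nz2 fe ff (zdeg_compat F) uh uz fineG).
  exact: (fine_frame_equivalent nz2 fe' ff (z2deg_compat F) uh uz2 fineG).
- by split; [apply: frame_universal_group uz|apply: frame_universal_group uz2].
Qed.
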